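(* Let $a<q$ be positive integers with $\gcd(a,q)=1$, let $\Lambda$ denote the von Mangoldt function and let $\varepsilon>0$ be a small number. Then, as $x\to\infty$, \[ \sum_{n\leq x} \Lambda\left( q[x/n]+a \right) = c(a,q)\, x + O\left( x^{(2+\varepsilon)/3}\log^2 x \right), \] where the density constant is \[ c(a,q)=\sum_{n\geq 1}\frac{\Lambda(qn+a)}{n(n+1)}>0. \]
   Context: $[t]$ denotes the largest integer not exceeding $t$. The von Mangoldt function is $\Lambda(m)=\log p$ if $m=p^k$ for a prime $p$ and an integer $k\geq 1$, and $\Lambda(m)=0$ otherwise. The sum is over positive integers $n\le x$. *)

(* Defs.v *)
From Stdlib Require Import Reals.
From Coquelicot Require Import Coquelicot.
From mathcomp Require Import all_boot.

(* von Mangoldt function on nat: Lambda m = ln p if m = p^k with p prime,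
   k >= 1, and 0 otherwise.  Any such p, k satisfy p <= m and k <= m
   (for m >= 1), so searching over 'I_m.+1 * 'I_m.+1 is exhaustive. *)
Definition vonMangoldt (m : nat) : R :=
  match [pick pk : 'I_m.+1 * 'I_m.+1 |
          (prime pk.1 && (0 < pk.2) && (pk.1 ^ pk.2 == m))%N] with
  | Some pk => ln (INR pk.1)
  | None => R0
  end.

Definition floor_nat (t : R) : nat := Z.to_nat (Int_part t).

Definition S_sum (a q : nat) (x : R) : R :=
  sum_n_m (fun n : nat => vonMangoldt (q * floor_nat (x / INR n) + a)%N)
          1 (floor_nat x).

(* Main.v *)
From Stdlib Require Import Reals.
From mathcomp Require Import all_boot all_order all_algebra all_fingroup Rstruct.
From mathcomp Require Import ring lra zify.
From Coquelicot Require Import Coquelicot.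
Require Import Defs.
Import Order.TTheory GRing.Theory Num.Theory.
Local Open Scope ring_scope.
Local Arguments ln _%_ring_scope.

(** With [X = [x]] and [h j = Lambda (q j + a)], counting the [n] with
    [[X / n] = j] turns the sum into [sum_j h j ([X / j] - [X / (j + 1)])]; a cut
    at [j ~ sqrt X] and [h j = O(log j)] give the error [O(sqrt x log x)].

    That [c > 0] is Dirichlet's theorem, proved here without complex characters.
    Let [G] be the group of units mod [q], and let [P_N(F)] be the sum of
    [Lambda(n) F(n) / n] over [n <= N], for [F : G -> R]. If [F] has sum [0] over
    [G] and [(L F)(u) = sum_n F(u n) / n], then [P_N(L F) = O(1)]; if moreover
    [L F = 0], Moebius inversion gives [P_N(F) = - F(1) log N + O(1)]. Let [rho]
    be a limit point of the distributions [P_N / log N] on [G]. Convolution by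
    [rho] commutes with [L], so it maps functions of sum [0] into the kernel of
    [L], where it acts as [-1]; hence [rho * rho + rho] is twice the uniform
    distribution. If [rho a = 0], this relation forces [1 - #|G| rho] to be a
    real character [chi] with [rho(chi) = -1], so that [L(1, chi) = 0]. This
    contradicts the divergence of [sum_n (1 * chi)(n) / sqrt n], which the
    hyperbola method bounds when [L(1, chi) = 0]. *)

(** * Logarithms, divisor sums and the von Mangoldt function *)

Lemma ln_natM (m n : nat) : (0 < m)%N -> (0 < n)%N ->
  ln (m * n)%:R = ln m%:R + ln n%:R.
Proof.
move=> m0 n0; rewrite natrM; apply: ln_mult; apply/RltP;
  by rewrite R0E ltr0n.
Qed.

Lemma ln_ler (x y : R) : 0 < x -> x <= y -> ln x <= ln y.
Proof. by move=> x0 xy; apply/RleP/ln_le; [apply/RltP | apply/RleP]. Qed.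

Lemma ln1r : ln 1 = 0 :> R.
Proof. exact: ln_1. Qed.

(** The library logarithm takes the value 0 outside the positive reals, so the comparisons below can
    include the argument 0. *)
Lemma ln0r : ln 0 = 0 :> R.
Proof. by rewrite /ln; case: Rlt_dec => // h; case: (Rlt_irrefl 0). Qed.

Lemma ln_nat_ge0 (n : nat) : 0 <= ln n%:R.
Proof.
case: n => [|n]; first by rewrite ln0r.
by rewrite -ln1r ln_ler ?ltr01 // ler1n.
Qed.

Lemma ler_ln_nat (m n : nat) : (m <= n)%N -> ln m%:R <= ln n%:R.
Proof.
case: m => [|m] mn; first by rewrite ln0r ln_nat_ge0.
by rewrite ln_ler ?ltr0n // ler_nat.
Qed.

Lemma ln_le_subr1 (x : R) : 0 < x -> ln x <= x - 1.
Proof.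
move=> x0; suff: 1 + ln x <= x by lra.
have -> : x = exp (ln x) by rewrite exp_ln //; apply/RltP.
rewrite ln_exp; apply/RleP; have [l0|/eqP l0] := eqVneq (ln x) 0.
  by rewrite l0 addr0 exp_0; right.
by left; apply: exp_ineq1; rewrite R0E.
Qed.

Lemma ln_pos (n : nat) : (1 < n)%N -> 0 < ln n%:R.
Proof.
move=> n1; rewrite -ln1r; apply/RltP/ln_increasing; apply/RltP.
  by rewrite R0E ltr01.
by rewrite ltr1n.
Qed.

Lemma ln_natS (n : nat) : n%:R * (ln n.+1%:R - ln n%:R) <= 1 :> R.
Proof.
case: n => [|n]; first by rewrite mul0r ler01.
have n0 : 0 < n.+1%:R :> R by rewrite ltr0n.
have n2 : 0 < n.+2%:R :> R by rewrite ltr0n.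
have n0' : n.+1%:R != 0 :> R by rewrite gt_eqF.
have -> : ln n.+2%:R - ln n.+1%:R = ln (n.+2%:R / n.+1%:R).
  rewrite -RdivE ln_div //; try exact/RltP.
have h := ln_le_subr1 _ (divr_gt0 n2 n0).
apply: le_trans (ler_wpM2l (ltW n0) h) _.
rewrite mulrBr mulrCA divff // mulr1 mulr1 -(natr1 n.+1); lra.
Qed.

(** Equivalent to [N^N <= e^N N!]. Passing from [N] to [N.+1] raises each of the [N] terms by
    [ln N.+1 - ln N], which is at most 1 in total by [ln_natS]. *)
Lemma sum_ln_ratio (N : nat) :
  \sum_(1 <= n < N.+1) (ln N%:R - ln n%:R) <= N%:R :> R.
Proof.
elim: N => [|N IH]; first by rewrite big_geq.
rewrite big_nat_recr //= subrr addr0.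
rewrite (eq_bigr (fun n => (ln N%:R - ln n%:R) + (ln N.+1%:R - ln N%:R))); last first.
  by move=> n _; lra.
rewrite big_split /= sumr_const_nat subn1 /= -[X in _ + X]mulr_natl.
by have := ln_natS N; rewrite -(natr1 N); lra.
Qed.

(** Both sides run over the pairs with [d * m <= N]. In the induction, [N.+1 %/ d] exceeds [N %/ d]
    by one exactly when [d] divides [N.+1], which brings in the pairs of product [N.+1]. *)
Lemma dirichlet_hyperbola (F : nat -> nat -> R) (N : nat) :
  \sum_(1 <= n < N.+1) \sum_(1 <= d < n.+1 | (d %| n)%N) F d (n %/ d)%N =
  \sum_(1 <= d < N.+1) \sum_(1 <= m < (N %/ d).+1) F d m.
Proof.
elim: N => [|N IH]; first by rewrite !big_geq.
rewrite [LHS]big_nat_recr //= IH [in RHS]big_nat_recr //= divnn /=.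
rewrite [X in _ + X = _]big_mkcond /= [X in _ + X = _]big_nat_recr //=.
rewrite dvdnn divnn /= big_nat1 addrA.
congr (_ + _); rewrite -big_split /=.
apply: eq_big_nat => d /andP[d1 dN].
rewrite !divnS //; case: ifP => hd; last by rewrite add0n addr0.
by rewrite hd !add1n [in RHS]big_nat_recr.
Qed.

(** A divisor of [p * n] prime to [p] divides [n] by Gauss's lemma; the others are [p * d] with [d]
    dividing [n]. Since [p] may divide [n], this serves as the induction step for divisor sums. *)
Lemma divisor_sum_prime (F : nat -> R) (p n : nat) : prime p -> (0 < n)%N ->
  \sum_(1 <= d < (p * n).+1 | (d %| p * n)%N) F d =
  \sum_(1 <= d < n.+1 | (d %| n)%N && ~~ (p %| d)%N) F d +
  \sum_(1 <= d < n.+1 | (d %| n)%N) F (p * d)%N.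
Proof.
move=> pp n0; have p0 := prime_gt0 pp.
rewrite (bigID (fun d => p %| d)%N) /= addrC; congr (_ + _).
  rewrite (big_cat_nat (n := n.+1)) //= ?ltnS ?leq_pmull //.
  rewrite [X in _ + X]big_nat_cond [X in _ + X]big1 ?addr0.
    apply: eq_bigl => d; apply/idP/idP => /andP[h1 h2]; rewrite h2 andbT.
      by rewrite -(@Gauss_dvdr d p) // coprime_sym prime_coprime.
    by rewrite dvdn_mull.
  move=> d /andP[/andP[nd _] /andP[h1 h2]].
  have : (d %| n)%N by rewrite -(@Gauss_dvdr d p) // coprime_sym prime_coprime.
  by move=> /(dvdn_leq n0); rewrite leqNgt nd.
rewrite -[LHS]big_filter -[RHS]big_filter -[RHS](big_map (muln p) xpredT F).
apply: perm_big; apply: uniq_perm.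
- by rewrite filter_uniq // iota_uniq.
- rewrite map_inj_uniq ?filter_uniq ?iota_uniq // => x y /eqP.
  by rewrite eqn_pmul2l // => /eqP.
move=> d; rewrite mem_filter mem_index_iota; apply/idP/mapP.
  move=> /andP[/andP[h /dvdnP[k dE]]]; subst d; rewrite ltnS => /andP[k0 hk].
  rewrite [(k * p)%N]mulnC dvdn_pmul2l // in h; exists k; last by rewrite mulnC.
  rewrite mem_filter h mem_index_iota ltnS (dvdn_leq n0 h) andbT.
  by rewrite muln_gt0 in k0; case/andP: k0.
case=> k; rewrite mem_filter mem_index_iota ltnS => /andP[h /andP[k0 kn]] ->.
by rewrite dvdn_pmul2l // h dvdn_mulr //= muln_gt0 p0 k0 ltnS leq_mul2l kn orbT.
Qed.

Variant vonMangoldt_spec (m : nat) : R -> Prop :=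
| VonMangoldtPfactor p k of prime p & m = (p ^ k.+1)%N :
    vonMangoldt_spec m (ln p%:R)
| VonMangoldtNone of (forall p k, prime p -> m <> (p ^ k.+1)%N) :
    vonMangoldt_spec m 0.

Lemma vonMangoldtP (m : nat) : vonMangoldt_spec m (vonMangoldt m).
Proof.
rewrite /vonMangoldt; case: pickP => [[p k] /=|h].
  move=> /andP[/andP[pp k0] /eqP e]; rewrite INRE; case: k k0 e => -[//|k] /= _ _ e.
  exact: (@VonMangoldtPfactor _ p k).
apply: VonMangoldtNone => p k pp e.
have p1 := prime_gt1 pp.
have pm : (p < m.+1)%N by rewrite ltnS e -{1}(expn1 p) leq_pexp2l // prime_gt0.
have km : (k.+1 < m.+1)%N by rewrite ltnS e ltnW // ltn_expl.
by have := h (Ordinal pm, Ordinal km); rewrite /= pp e eqxx.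
Qed.

Lemma vonMangoldt_pfactor (p k : nat) : prime p ->
  vonMangoldt (p ^ k.+1)%N = ln p%:R.
Proof.
move=> pp; case: vonMangoldtP => [p' k' pp' e|/(_ p k pp) //].
by rewrite -(pdiv_pfactor k pp) e pdiv_pfactor.
Qed.

Lemma vonMangoldt_ge0 (m : nat) : 0 <= vonMangoldt m.
Proof. by case: vonMangoldtP => // p k _ _; exact: ln_nat_ge0. Qed.

Lemma vonMangoldt_le_ln (m : nat) : vonMangoldt m <= ln m%:R.
Proof.
case: vonMangoldtP => [p k pp ->|_]; last exact: ln_nat_ge0.
by rewrite ler_ln_nat // -{1}(expn1 p) leq_pexp2l // prime_gt0.
Qed.

Lemma vonMangoldt1 : vonMangoldt 1 = 0.
Proof. by apply/le_anti; rewrite vonMangoldt_ge0 -ln1r vonMangoldt_le_ln. Qed.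

(** [p * d] is a prime power only if [d] is a power of [p]; [d = 1] is the case that creates a new
    [ln p]. *)
Lemma vonMangoldt_mulp (p d : nat) : prime p -> (0 < d)%N ->
  vonMangoldt (p * d) =
  (if (p %| d)%N then vonMangoldt d else if d == 1%N then ln p%:R else 0).
Proof.
move=> pp d0.
have aux p' k' : prime p' -> (p * d = p' ^ k'.+1)%N -> p' = p /\ (d = p ^ k')%N.
  move=> pp' e; have : (p %| p' ^ k'.+1)%N by rewrite -e dvdn_mulr.
  rewrite Euclid_dvdX // dvdn_prime2 // andbT => /eqP pE; subst p'; split=> //.
  by move: e; rewrite expnS => /eqP; rewrite eqn_pmul2l ?prime_gt0 // => /eqP.
case: (vonMangoldtP (p * d)) => [p' k' pp' /(aux _ _ pp') [-> ->]|h].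
  case: k' => [|k]; first by rewrite expn0 dvdn1 eqxx; case: eqP => // p1; rewrite p1 in pp.
  by rewrite dvdn_exp // vonMangoldt_pfactor.
case: ifP => pd.
  case: vonMangoldtP => // p' k' pp' e; exfalso; apply: (h p k'.+1 pp).
  move: pd; rewrite e Euclid_dvdX // dvdn_prime2 // andbT => /eqP ->.
  by rewrite -expnS.
by case: eqP => // d1; exfalso; apply: (h p 0%N pp); rewrite d1 muln1 expn1.
Qed.

(** Write [n = p * m] with [p] the smallest prime factor. Among the divisors [p * d], those with [p]
    dividing [d] contribute [vonMangoldt d] and complete the sum for [m]; among the rest only
    [d = 1] counts, giving [ln p]. *)
Lemma divisor_sum_vonMangoldt (n : nat) : (0 < n)%N ->
  \sum_(1 <= d < n.+1 | (d %| n)%N) vonMangoldt d = ln n%:R.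
Proof.
have [k] := ubnP n; elim: k n => // k IH n nk n0.
have [n1|n1] := leqP n 1.
  have -> : n = 1%N by lia.
  by rewrite big_mkcond big_nat1 /= vonMangoldt1 ln1r.
have pp := pdiv_prime n1; set p := pdiv n in pp *.
have p1 := prime_gt1 pp.
have /dvdnP[m e] := pdiv_dvd n; rewrite -/p mulnC in e.
have m0 : (0 < m)%N by case: m e => // e; rewrite e muln0 in n0.
have mn : (m < n)%N by rewrite e; nia.
rewrite e divisor_sum_prime // ln_natM ?(ltnW p1) //.
rewrite -(IH m) // ?(leq_trans mn) //.
have e1 : \sum_(1 <= d < m.+1 | (d %| m)%N && ~~ (p %| d)%N) vonMangoldt (p * d) = ln p%:R.
  rewrite big_mkcond /= big_ltn //= big_nat_cond big1 ?addr0.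
    rewrite dvd1n dvdn1 /=; case: eqP => [pE|_]; first by rewrite pE in pp.
    by rewrite /= muln1 -[X in vonMangoldt X](expn1 p) vonMangoldt_pfactor.
  move=> d /andP[/andP[d1 dm] _]; case: ifP => // /andP[_ /negbTE pd].
  by rewrite vonMangoldt_mulp ?(ltnW d1) // pd gtn_eqF.
have e2 : \sum_(1 <= d < m.+1 | (d %| m)%N && (p %| d)%N) vonMangoldt (p * d) =
          \sum_(1 <= d < m.+1 | (d %| m)%N && (p %| d)%N) vonMangoldt d.
  rewrite big_nat_cond [RHS]big_nat_cond.
  apply: eq_bigr => d /andP[/andP[d0 _] /andP[_ pd]].
  by rewrite vonMangoldt_mulp // pd.
rewrite [X in _ + X = _](bigID (fun d => p %| d)%N) /= e1 e2.
by rewrite [X in _ = _ + X](bigID (fun d => p %| d)%N) /=; ring.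
Qed.

(** * Moebius inversion and Chebyshev's bound *)

(** The Moebius function, computed by peeling off the smallest prime factor: a repeated factor gives
    0, a simple one flips the sign. The argument decreases at each step, so [n] itself is enough
    fuel. *)
Fixpoint mobius_rec (fuel n : nat) : R :=
  if fuel is k.+1 then
    if (n <= 1)%N then 1 else
    let m := (n %/ pdiv n)%N in
    if (pdiv n %| m)%N then 0 else - mobius_rec k m
  else 1.

Definition mobius (n : nat) : R := mobius_rec n n.

Lemma mobius_rec_fuel (k l n : nat) : (n <= k)%N -> (n <= l)%N ->
  mobius_rec k n = mobius_rec l n.
Proof.
elim: k l n => [|k IH] [|l] n //=.
- by rewrite leqn0 => /eqP ->.
- by move=> _; rewrite leqn0 => /eqP ->.
move=> nk nl; case: leqP => // n1; case: ifP => // _.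
have h : (n %/ pdiv n < n)%N by rewrite ltn_Pdiv ?(ltnW n1) // prime_gt1 ?pdiv_prime.
by rewrite (IH l) //; lia.
Qed.

(** The recursion peels off only the smallest prime factor, whence the hypothesis on [pdiv]. *)
Lemma mobius_mulp (p d : nat) : prime p -> (0 < d)%N -> pdiv (p * d) = p ->
  mobius (p * d) = (if (p %| d)%N then 0 else - mobius d).
Proof.
move=> pp d0 e; have p1 := prime_gt1 pp.
have h : (1 < p * d)%N by nia.
rewrite /mobius; case E : (p * d)%N => [|n]; first by rewrite E in h.
rewrite [LHS]/= -E leqNgt h /= e mulKn ?(ltnW p1) //; case: ifP => // _.
by rewrite (mobius_rec_fuel n d) //; nia.
Qed.

Lemma mobius_norm_le1 (n : nat) : `|mobius n| <= 1.
Proof.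
rewrite /mobius; move: {1}n => k; elim: k n => [|k IH] n /=.
  by rewrite normr1.
by case: ifP => _; [rewrite normr1 | case: ifP => _; rewrite ?normr0 ?ler01 ?normrN].
Qed.

(** With [n = p * m] and [p] the smallest prime factor, each divisor [d] of [m] prime to [p] cancels
    against [p * d], and [p * d] contributes 0 when [p] divides [d]. *)
Lemma divisor_sum_mobius (n : nat) : (0 < n)%N ->
  \sum_(1 <= d < n.+1 | (d %| n)%N) mobius d = (n == 1%N)%:R.
Proof.
move=> n0; have [n1|n1] := leqP n 1.
  have -> : n = 1%N by lia.
  by rewrite big_mkcond big_nat1.
have pp := pdiv_prime n1; set p := pdiv n in pp *.
have /dvdnP[m e] := pdiv_dvd n; rewrite -/p mulnC in e.
have m0 : (0 < m)%N by case: m e => // e; rewrite e muln0 in n0.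
rewrite gtn_eqF // e divisor_sum_prime //.
rewrite [X in _ + X](bigID (fun d => p %| d)%N) /= big_nat_cond.
rewrite [X in _ + (X + _)]big_nat_cond [X in _ + (_ + X)]big_nat_cond.
(* The smallest prime factor of [p * d] also divides [n], so it is not below [p]. *)
have pdivE d : (0 < d)%N -> (d %| m)%N -> pdiv (p * d) = p.
  move=> d0 dm; apply/eqP; rewrite eqn_leq; have p0 := prime_gt0 pp.
  have h : (1 < p * d)%N by have := prime_gt1 pp; nia.
  rewrite pdiv_min_dvd ?prime_gt1 ?dvdn_mulr //=.
  apply: (@pdiv_min_dvd n); first by rewrite prime_gt1 ?pdiv_prime.
  by rewrite (dvdn_trans (pdiv_dvd _)) // e dvdn_pmul2l.
rewrite [X in _ + (X + _)]big1 ?add0r; last first.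
  move=> d /andP[/andP[d0 _] /andP[dm pd]].
  by rewrite mobius_mulp ?pdivE // pd.
rewrite -big_split big1 //= => d /andP[/andP[d0 _] /andP[dm /negbTE pd]].
by rewrite mobius_mulp ?pdivE // pd subrr.
Qed.

Lemma divisor_sum_quotient (F : nat -> R) (n k : nat) : (0 < n)%N -> (k %| n)%N ->
  \sum_(1 <= e < (n %/ k).+1 | (e %| n %/ k)%N) F e =
  \sum_(1 <= e < n.+1 | (k * e %| n)%N) F e.
Proof.
move=> n0 kn; have k0 : (0 < k)%N by rewrite (dvdn_gt0 n0).
rewrite [RHS](big_cat_nat (n := (n %/ k).+1)) //= ?ltnS ?leq_div //.
rewrite [X in _ = _ + X]big_nat_cond [X in _ = _ + X]big1 ?addr0.
  by apply: eq_bigl => e; rewrite dvdn_divRL // mulnC.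
move=> e /andP[/andP[h _] /(dvdn_leq n0)].
by rewrite mulnC -leq_divRL // leqNgt h.
Qed.

(** Both sides sum [f k * g e] over the pairs with [k * e] dividing [n]: associativity of Dirichlet
    convolution with 1 in the middle. *)
Lemma divisor_sum_assoc (f g : nat -> R) (n : nat) : (0 < n)%N ->
  \sum_(1 <= k < n.+1 | (k %| n)%N)
    f k * \sum_(1 <= e < (n %/ k).+1 | (e %| n %/ k)%N) g e =
  \sum_(1 <= e < n.+1 | (e %| n)%N)
    g e * \sum_(1 <= k < (n %/ e).+1 | (k %| n %/ e)%N) f k.
Proof.
move=> n0.
have aux (F G : nat -> R) : \sum_(1 <= k < n.+1 | (k %| n)%N)
    F k * \sum_(1 <= e < (n %/ k).+1 | (e %| n %/ k)%N) G e =
  \sum_(1 <= k < n.+1) \sum_(1 <= e < n.+1) (if (k * e %| n)%N then F k * G e else 0).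
  rewrite big_mkcond; apply: eq_bigr => k _; rewrite -[RHS]big_mkcond /=.
  case: ifP => kn; first by rewrite divisor_sum_quotient // mulr_sumr.
  by rewrite big1 // => e /(dvdn_trans (dvdn_mulr e (dvdnn k))); rewrite kn.
rewrite !aux exchange_big_nat /=; apply: eq_bigr => k _; apply: eq_bigr => e _.
by rewrite mulnC mulrC.
Qed.

(** Moebius inversion of [divisor_sum_vonMangoldt], with [ln (n / d) = ln n - ln d]. The weight uses
    [ln N] rather than [ln n] because [ln N - ln d] does not depend on [n], is nonnegative for
    [d <= N], and has sum at most [N]. *)
Lemma divisor_sum_mobius_ln (N n : nat) : (0 < n)%N ->
  \sum_(1 <= d < n.+1 | (d %| n)%N) mobius d * (ln N%:R - ln d%:R) =
  vonMangoldt n + (n == 1%N)%:R * ln N%:R.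
Proof.
move=> n0.
have h : \sum_(1 <= k < n.+1 | (k %| n)%N) mobius k * ln (n %/ k)%:R = vonMangoldt n.
  transitivity (\sum_(1 <= k < n.+1 | (k %| n)%N)
    mobius k * \sum_(1 <= e < (n %/ k).+1 | (e %| n %/ k)%N) vonMangoldt e).
    rewrite big_nat_cond [RHS]big_nat_cond; apply: eq_bigr => k /andP[/andP[k0 _] kn].
    by rewrite divisor_sum_vonMangoldt // divn_gt0 // dvdn_leq.
  rewrite divisor_sum_assoc // big_mkcond big_nat_recr //= dvdnn.
  rewrite divisor_sum_mobius ?divnn n0 // eqxx mulr1.
  rewrite big_nat_cond big1 ?add0r // => e /andP[/andP[e0 en] _].
  case: ifP => // /dvdnP[m E]; rewrite divisor_sum_mobius; last first.
    by rewrite divn_gt0 // ltnW.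
  rewrite E mulnK // in en *.
  by case: eqP => [m1|_]; [move: en; rewrite m1 mul1n ltnn | rewrite mulr0].
rewrite -h -divisor_sum_mobius // mulr_suml -big_split /=.
have -> : \sum_(1 <= d < n.+1 | (d %| n)%N) mobius d * (ln N%:R - ln d%:R) =
  \sum_(1 <= d < n.+1 | (d %| n)%N)
    (mobius d * ln (n %/ d)%:R + mobius d * ln N%:R - mobius d * ln n%:R).
  rewrite big_nat_cond [RHS]big_nat_cond; apply: eq_bigr => k /andP[/andP[k0 _] kn].
  have -> : ln n%:R = ln k%:R + ln (n %/ k)%:R.
    have nk0 : (0 < n %/ k)%N by rewrite divn_gt0 // dvdn_leq.
    by rewrite -(ln_natM k (n %/ k) k0 nk0) mulnC divnK.
  ring.
rewrite sumrB -[X in _ - X]mulr_suml divisor_sum_mobius //.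
by case: eqP => [->|_]; rewrite ?ln1r ?mul0r ?mulr0 oppr0 addr0.
Qed.

Lemma sum_ln_hyperbola (N : nat) :
  \sum_(1 <= n < N.+1) ln n%:R =
  \sum_(1 <= d < N.+1) vonMangoldt d * (N %/ d)%:R.
Proof.
rewrite (eq_big_nat _ _ (F2 := fun n => \sum_(1 <= d < n.+1 | (d %| n)%N)
   (fun d _ => vonMangoldt d) d (n %/ d)%N)); last first.
  by move=> n /andP[n0 _]; rewrite divisor_sum_vonMangoldt.
rewrite (dirichlet_hyperbola (fun d _ => vonMangoldt d)).
apply: eq_bigr => d _; by rewrite sumr_const_nat subn1 mulr_natr.
Qed.

(** A crude bound [e^(2n)] for the central binomial coefficient, by induction from
    [2n + 1 <= 2(n + 1)] and [ln 2 <= 1]. *)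
Lemma sum_ln_double (n : nat) :
  \sum_(1 <= k < (n + n).+1) ln k%:R <=
  2 * \sum_(1 <= k < n.+1) ln k%:R + 2 * n%:R.
Proof.
elim: n => [|n IH]; first by rewrite !big_geq //; lra.
have e1 : \sum_(1 <= k < (n.+1 + n.+1).+1) ln k%:R =
  \sum_(1 <= k < (n + n).+1) ln k%:R + ln (n + n).+1%:R + ln (n + n).+2%:R.
  by rewrite addnS addSn big_nat_recr //= big_nat_recr.
rewrite e1 [X in _ <= _ * X + _]big_nat_recr //=.
have h2 : ln 2%:R <= 1 by have := ln_le_subr1 2%:R (ltr0n _ 2); lra.
have e : ln (n + n).+2%:R = ln 2%:R + ln n.+1%:R.
  by rewrite -ln_natM //; congr (ln _%:R); lia.
have h3 : ln (n + n).+1%:R <= ln (n + n).+2%:R by rewrite ler_ln_nat.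
have e3 : n.+1%:R = n%:R + 1 :> R by rewrite natr1.
lra.
Qed.

Definition chebyshev_psi (N : nat) : R := \sum_(1 <= d < N.+1) vonMangoldt d.

(** Chebyshev's argument: in the logarithm of the central binomial coefficient, [vonMangoldt d] has
    coefficient [(2n %/ d) - 2 (n %/ d)], which is nonnegative, and at least 1 for [n < d <= 2n]. *)
Lemma chebyshev_psi_double (n : nat) :
  chebyshev_psi (n + n) <= chebyshev_psi n + 2 * n%:R.
Proof.
have h := sum_ln_double n; rewrite !sum_ln_hyperbola in h.
suff : chebyshev_psi (n + n) - chebyshev_psi n <=
  \sum_(1 <= d < (n + n).+1) vonMangoldt d * ((n + n) %/ d)%:R
  - 2 * \sum_(1 <= d < n.+1) vonMangoldt d * (n %/ d)%:R by lra.
have split_sum (F : nat -> R) : \sum_(1 <= d < (n + n).+1) F d =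
    \sum_(1 <= d < n.+1) F d + \sum_(n.+1 <= d < (n + n).+1) F d.
  by rewrite (big_cat_nat (n := n.+1)) //; lia.
rewrite /chebyshev_psi !split_sum.
have h1 : \sum_(n.+1 <= d < (n + n).+1) vonMangoldt d <=
  \sum_(n.+1 <= d < (n + n).+1) vonMangoldt d * ((n + n) %/ d)%:R.
  rewrite big_nat_cond [X in _ <= X]big_nat_cond; apply: ler_sum => d /andP[/andP[d1 d2] _].
  rewrite -{1}[vonMangoldt d]mulr1 ler_wpM2l ?vonMangoldt_ge0 // ler1n divn_gt0 //; lia.
have h2 : 2 * \sum_(1 <= d < n.+1) vonMangoldt d * (n %/ d)%:R <=
  \sum_(1 <= d < n.+1) vonMangoldt d * ((n + n) %/ d)%:R.
  rewrite mulr_sumr big_nat_cond [X in _ <= X]big_nat_cond.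
  apply: ler_sum => d /andP[/andP[d1 d2] _].
  rewrite mulrCA ler_wpM2l ?vonMangoldt_ge0 //.
  rewrite -natrM ler_nat leq_divRL // -mulnA; have := leq_trunc_div n d; lia.
lra.
Qed.

Lemma chebyshev_psi_le (N : nat) : chebyshev_psi N <= 8 * N%:R.
Proof.
have [k] := ubnP N; elim: k N => // k IH N Nk.
have [N1|N1] := leqP N 1.
  have h : (N == 0)%N || (N == 1)%N by lia.
  rewrite /chebyshev_psi; case/orP: h => /eqP ->; first by rewrite big_geq //; lra.
  by rewrite big_nat1 vonMangoldt1; lra.
have hm : chebyshev_psi N <= chebyshev_psi (uphalf N + uphalf N).
  rewrite /chebyshev_psi [X in _ <= X](big_cat_nat (n := N.+1)) //=; last by lia.
  by rewrite lerDl sumr_ge0 // => d _; exact: vonMangoldt_ge0.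
have h2 := chebyshev_psi_double (uphalf N).
have h3 := IH (uphalf N) ltac:(lia).
(* The recursion yields [10 * uphalf N], and this inequality, valid for [N >= 2], brings it below
   [8 * N]. *)
have h4 : 4 * (uphalf N)%:R <= 3 * N%:R :> R by rewrite -!natrM ler_nat; lia.
have h5 : 0 <= N%:R :> R by rewrite ler0n.
lra.
Qed.

(** * Periodic functions and their L-sums *)

Lemma abel_sum_le (h w : nat -> R) (B : R) (M N : nat) :
  (forall n, `|\sum_(0 <= i < n) h i| <= B) ->
  (forall n, (M <= n)%N -> 0 <= w n.+1 <= w n) -> 0 <= w M -> (M <= N)%N ->
  `|\sum_(M <= n < N) h n * w n| <= 2 * B * w M.
Proof.
move=> hB hw wM; set H := fun n => \sum_(0 <= i < n) h i.
have w_ge0 n : (M <= n)%N -> 0 <= w n.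
  rewrite leq_eqVlt => /orP[/eqP <- //|]; case: n => // n; rewrite ltnS => Mn.
  by case/andP: (hw n Mn).
(* Summation by parts: the differences of [w] telescope to [B * (w M - w N)], and the two boundary
   terms add [B * w N] and [B * w M]. *)
move=> MN; suff h1 : `|\sum_(M <= n < N) h n * w n - H N * w N + H M * w M|
    <= B * (w M - w N).
  have h2 : `|H N * w N| <= B * w N.
    by rewrite normrM (ger0_norm (w_ge0 _ MN)) ler_wpM2r ?w_ge0 ?hB.
  have h3 : `|H M * w M| <= B * w M.
    by rewrite normrM (ger0_norm wM) ler_wpM2r ?hB.
  move: h1 h2 h3; rewrite !ler_norml => /andP[? ?] /andP[? ?] /andP[? ?].
  by apply/andP; split; lra.
elim: N MN => [|N IH].
  by rewrite leqn0 => /eqP ->; rewrite big_geq // subrr mulr0 add0r addrC subrr normr0.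
rewrite leq_eqVlt => /orP[/eqP <-|].
  by rewrite big_geq // subrr mulr0 add0r addrC subrr normr0.
rewrite ltnS => MN; rewrite big_nat_recr //=.
have HS : H N.+1 = H N + h N by rewrite /H big_nat_recr.
have /andP[w0 w1] := hw N MN.
have -> : \sum_(M <= i < N) h i * w i + h N * w N - H N.+1 * w N.+1 + H M * w M =
  (\sum_(M <= i < N) h i * w i - H N * w N + H M * w M) + H N.+1 * (w N - w N.+1).
  by rewrite HS; ring.
apply: le_trans (ler_normD _ _) _.
have h4 : `|H N.+1 * (w N - w N.+1)| <= B * (w N - w N.+1).
  by rewrite normrM (@ger0_norm _ (w N - w N.+1)) ?subr_ge0 // ler_wpM2r ?subr_ge0 ?hB.
have := IH MN; lra.
Qed.

Lemma periodic_partial_sum_le (h : nat -> R) (q N : nat) : (0 < q)%N ->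
  (forall n, h (n + q)%N = h n) -> \sum_(0 <= r < q) h r = 0 ->
  `|\sum_(0 <= n < N) h n| <= \sum_(0 <= r < q) `|h r|.
Proof.
move=> q0 hq hsum; have [k] := ubnP N; elim: k N => // k IH N Nk.
have [Nq|Nq] := leqP q N; last first.
  apply: le_trans (ler_norm_sum _ _ _) _.
  rewrite [X in _ <= X](big_cat_nat (n := N)) //= ?(ltnW Nq) //.
  by rewrite lerDl sumr_ge0.
rewrite (big_cat_nat (n := q)) //= hsum add0r.
rewrite -{1}[q]add0n big_addn (eq_bigr h); last by move=> n _; rewrite hq.
by apply: IH; lia.
Qed.

(** Completeness, keeping the rate: the decay [c / M.+1] is what makes the errors summable over
    divisors later on. *)
Lemma cauchy_rate_limit (s : nat -> R) (c : R) :
  (forall M N, (M <= N)%N -> `|s N - s M| <= c / M.+1%:R) ->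
  exists L, forall M, `|s M - L| <= c / M.+1%:R.
Proof.
move=> hs.
have c0 : 0 <= c.
  by have := le_trans (normr_ge0 _) (hs 0%N 0%N (leqnn _)); rewrite divr1.
have crit : Cauchy_crit s.
  move=> e /RltP; rewrite R0E => e0.
  have [n hn] : exists n : nat, c / n.+1%:R < e.
    exists (Num.bound (c / e)); rewrite ltr_pdivrMr ?ltr0n // -ltr_pdivrMl //.
    rewrite mulrC; apply: lt_le_trans (archi_boundP _) _; first by rewrite divr_ge0 // ltW.
    by rewrite ler_nat.
  exists n => m k hm hk.
  have aux i j : (n <= i)%N -> (i <= j)%N -> `|s j - s i| < e.
    move=> ni ij; apply: le_lt_trans (hs i j ij) _; apply: le_lt_trans hn.
    by rewrite ler_wpM2l // lef_pV2 ?posrE ?ltr0n // ler_nat ltnS.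
  apply/RltP; rewrite RdistE.
  have [mk|km] := leqP m k; first by rewrite distrC aux //; lia.
  by rewrite aux //; lia.
have [L hL] := Rcomplete.R_complete s crit.
exists L => M; apply/ler_addgt0Pr => e e0.
have [n hn] := hL e (RltP e0).
have := hn (maxn n M) ltac:(lia); rewrite RdistE => /RltP h1.
have h2 := hs M (maxn n M) (leq_maxr _ _).
rewrite -[s M](subrK (s (maxn n M))) -addrA.
apply: le_trans (ler_normD _ _) _; rewrite distrC.
by apply: lerD h2 (ltW h1).
Qed.

Section ResidueClasses.
Variable k : nat.
Local Notation q := k.+2.
Local Notation G := {unit 'I_q}.
Implicit Types (F : G -> R) (u v : G).

(* A function on the units mod [q], viewed as a [q]-periodic function on [nat]
   vanishing off the integers coprime to [q]. *)
Definition zext F (n : nat) : R :=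
  if (insub (inZp n : 'I_q) : option G) is Some u then F u else 0.

Definition shift u F : G -> R := fun v => F (u * v)%g.

Variant zclass_spec (n : nat) : option G -> Prop :=
| ZclassUnit u of inZp n = val u : zclass_spec n (Some u)
| ZclassNone of (inZp n : 'I_q) \isn't a GRing.unit : zclass_spec n None.

Lemma zclassP (n : nat) : zclass_spec n (insub (inZp n : 'I_q)).
Proof.
case: insubP => [u _ e|h]; first by apply: ZclassUnit.
exact: ZclassNone.
Qed.

Lemma zextE F n u : inZp n = val u -> zext F n = F u.
Proof. by rewrite /zext => ->; rewrite valK. Qed.

Lemma zext_period F n : zext F (n + q) = zext F n.
Proof. 
have e : inZp (n + q) = inZp n :> 'I_q by apply: val_inj; rewrite /= modnDr.
by rewrite /zext e.
Qed.

Lemma inZpM (m n : nat) : inZp (m * n) = inZp m * inZp n :> 'I_q.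
Proof. by apply: val_inj; rewrite /= modnMm. Qed.

(** Substitute for the multiplicativity of a character: for a general [F], multiplying the argument
    by [d] translates [F] by the class of [d]. *)
Lemma zext_mul F d n : zext F (d * n) =
  if (insub (inZp d : 'I_q) : option G) is Some u then zext (shift u F) n else 0.
Proof.
case: zclassP => [u e|h].
  rewrite /zext; case: (zclassP n) => [v e'|h'].
    have E : inZp (d * n) = val (u * v)%g by rewrite inZpM e e'.
    by rewrite E valK.
  case: zclassP => // w E; exfalso; move/negP: h'; apply.
  have := valP w; rewrite -E inZpM unitrM e; by case/andP.
rewrite /zext; case: zclassP => // w E; exfalso; move/negP: h; apply.
have := valP w; rewrite -E inZpM unitrM; by case/andP.
Qed.

Lemma zext1 F : zext F 1 = F 1%g.
Proof. by apply: zextE. Qed.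

Lemma sum_zext F : \sum_(0 <= r < q) zext F r = \sum_u F u.
Proof.
rewrite big_mkord.
rewrite (bigID (fun i : 'I_q => i \is a GRing.unit)) /= [X in _ + X]big1 ?addr0; last first.
  by move=> i hi; rewrite /zext valZpK insubN.
rewrite (reindex_onto (val : G -> 'I_q) (insubd (1%g : G))) /=; last first.
  by move=> i hi; rewrite insubdK.
rewrite (eq_bigl predT); last by move=> u; rewrite valKd eqxx andbT (valP u).
by apply: eq_bigr => u _; rewrite (zextE _ _ u) // valZpK.
Qed.

Lemma sum_shift u F : \sum_v shift u F v = \sum_v F v.
Proof. by rewrite [RHS](reindex_inj (mulgI u)). Qed.

Definition l1norm F : R := \sum_v `|F v|.

Lemma l1norm_shift u F : l1norm (shift u F) = l1norm F.
Proof. by rewrite /l1norm [RHS](reindex_inj (mulgI u)). Qed.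

Lemma l1norm_ge0 F : 0 <= l1norm F.
Proof. by rewrite sumr_ge0. Qed.

Lemma zext_partial_sum_le F n : \sum_v F v = 0 ->
  `|\sum_(0 <= i < n) zext F i| <= l1norm F.
Proof.
move=> F0; rewrite /l1norm -(sum_zext (fun v => `|F v|)).
have -> : \sum_(0 <= r < q) zext (fun v => `|F v|) r = \sum_(0 <= r < q) `|zext F r|.
  by apply: eq_bigr => r _; rewrite /zext; case: insub => //; rewrite normr0.
apply: periodic_partial_sum_le => //; first exact: zext_period.
by rewrite sum_zext.
Qed.

Definition Lsum F (M : nat) : R := \sum_(1 <= n < M.+1) zext F n / n%:R.

(** Abel summation with weights [1 / n]. [LF] is the function [L F] of the overview; one constant
    serves all [u] because translation preserves [l1norm]. *)
Lemma Lsum_limit F : \sum_v F v = 0 ->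
  exists LF : G -> R, forall u M,
    `|Lsum (shift u F) M - LF u| <= 2 * l1norm F / M.+1%:R.
Proof.
move=> F0.
have h u : exists L, forall M, `|Lsum (shift u F) M - L| <= 2 * l1norm F / M.+1%:R.
  apply: cauchy_rate_limit => M N MN.
  rewrite /Lsum [X in `|X - _|](big_cat_nat (n := M.+1)) //= [X in X - _]addrC addrK.
  rewrite -(l1norm_shift u F).
  apply: (abel_sum_le (zext (shift u F)) (fun n => n%:R^-1)) => //.
  - by move=> n; apply: zext_partial_sum_le; rewrite sum_shift.
  - move=> n Mn; rewrite invr_ge0 ler0n /= lef_pV2 ?posrE ?ltr0n //; last by lia.
    by rewrite ler_nat.
  - by rewrite invr_ge0 ler0n.
exact: fin_all_exists h.
Qed.

End ResidueClasses.

(** * Mertens-type estimates *)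

Section MertensEstimates.
Variable k : nat.
Local Notation q := k.+2.
Local Notation G := {unit 'I_q}.
Implicit Types (F : G -> R) (u v : G).

Definition Psum F (N : nat) : R :=
  \sum_(1 <= d < N.+1) vonMangoldt d / d%:R * zext k F d.

Lemma sum_zext_divisor_sum (a : nat -> R) F N :
  \sum_(1 <= n < N.+1) zext k F n / n%:R * \sum_(1 <= d < n.+1 | (d %| n)%N) a d =
  \sum_(1 <= d < N.+1) a d / d%:R *
    \sum_(1 <= m < (N %/ d).+1) zext k F (d * m) / m%:R.
Proof.
rewrite (eq_big_nat _ _ (F2 := fun n => \sum_(1 <= d < n.+1 | (d %| n)%N)
   (fun d m => a d / d%:R * (zext k F (d * m) / m%:R)) d (n %/ d)%N)); last first.
  move=> n /andP[n0 _]; rewrite mulr_sumr big_nat_cond [RHS]big_nat_cond.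
  apply: eq_bigr => d /andP[/andP[d0 _] dn]; rewrite [(d * _)%N]mulnC divnK //.
  have -> : n%:R = d%:R * (n %/ d)%:R :> R by rewrite -natrM mulnC divnK.
  by rewrite invfM; ring.
rewrite (dirichlet_hyperbola (fun d m => a d / d%:R * (zext k F (d * m) / m%:R))).
by apply: eq_bigr => d _; rewrite mulr_sumr.
Qed.

(* Since [d * (N %/ d).+1 > N], an error [C / M.+1] at [M = N %/ d] is at most
   [C * d / N.+1]. *)
Lemma sum_zext_divisor_sum_approx (a : nat -> R) F (LF : G -> R) (C : R) N :
  (forall u M, `|Lsum k (shift k u F) M - LF u| <= C / M.+1%:R) ->
  `|\sum_(1 <= n < N.+1) zext k F n / n%:R * \sum_(1 <= d < n.+1 | (d %| n)%N) a d
    - \sum_(1 <= d < N.+1) a d / d%:R * zext k LF d|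
  <= C / N.+1%:R * \sum_(1 <= d < N.+1) `|a d|.
Proof.
move=> hL; have C0 : 0 <= C.
  by have := le_trans (normr_ge0 _) (hL 1%g 0%N); rewrite divr1.
rewrite sum_zext_divisor_sum -sumrB mulr_sumr.
apply: le_trans (ler_norm_sum _ _ _) _.
rewrite big_nat_cond [X in _ <= X]big_nat_cond.
apply: ler_sum => d /andP[/andP[d0 dN] _]; rewrite -mulrBr normrM normrM.
have dp : 0 < d%:R :> R by rewrite ltr0n.
have Np : 0 < N.+1%:R :> R by rewrite ltr0n.
have Mp : 0 < (N %/ d).+1%:R :> R by rewrite ltr0n.
have h : `|\sum_(1 <= m < (N %/ d).+1) zext k F (d * m) / m%:R - zext k LF d|
    <= C / (N %/ d).+1%:R.
  (* If [d] is not a unit mod [q], both the sum and [zext k LF d] vanish; otherwise this is the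
     hypothesis at the class of [d]. *)
  under eq_bigr do rewrite zext_mul.
  rewrite [zext k LF d]/zext; case: zclassP => [u _|_]; first exact: hL.
  rewrite big1 => [|i _]; last by rewrite mul0r.
  by rewrite subrr normr0 divr_ge0 // ltW.
rewrite -mulrA mulrC ler_wpM2r ?normr_ge0 //.
rewrite (@ger0_norm _ d%:R^-1) ?invr_ge0 ?(ltW dp) //.
apply: le_trans (ler_wpM2l _ h) _; first by rewrite invr_ge0 ltW.
rewrite mulrCA ler_wpM2l // -invfM lef_pV2 ?posrE ?mulr_gt0 //.
by rewrite -natrM ler_nat mulnC; apply: ltn_ceil.
Qed.

(** The weight [ln n / n] is not monotone near 1, so Abel summation is applied to [(ln n + 1) / n],
    decreasing from [n = 1] on, and to the correction [1 / n]. *)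
Lemma sum_zext_ln_le F N : \sum_v F v = 0 ->
  `|\sum_(1 <= n < N.+1) zext k F n / n%:R * ln n%:R| <= 4 * l1norm k F.
Proof.
move=> F0.
have hB n := zext_partial_sum_le k F n F0.
have h1 : `|\sum_(1 <= n < N.+1) zext k F n * ((ln n%:R + 1) / n%:R)|
    <= 2 * l1norm k F * ((ln 1%:R + 1) / 1%:R).
  apply: (abel_sum_le (zext k F) (fun n => (ln n%:R + 1) / n%:R)) => //.
  - move=> n n0; rewrite divr_ge0 ?addr_ge0 ?ln_nat_ge0 ?ler01 ?ler0n //=.
    have np : 0 < n%:R :> R by rewrite ltr0n.
    rewrite ler_pdivrMr ?ltr0n // mulrAC ler_pdivlMr //.
    rewrite -[X in _ <= _ * X]natr1.
    by have := ln_natS n; have := ln_nat_ge0 n; lra.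
  - by rewrite ln1r; lra.
have h2 : `|\sum_(1 <= n < N.+1) zext k F n * n%:R^-1| <= 2 * l1norm k F * 1%:R^-1.
  apply: (abel_sum_le (zext k F) (fun n => n%:R^-1)) => //.
  - move=> n n0; rewrite invr_ge0 ler0n /= lef_pV2 ?posrE ?ltr0n //.
    by rewrite ler_nat.
  - by rewrite invr_ge0 ler0n.
have -> : \sum_(1 <= n < N.+1) zext k F n / n%:R * ln n%:R =
  \sum_(1 <= n < N.+1) zext k F n * ((ln n%:R + 1) / n%:R) -
  \sum_(1 <= n < N.+1) zext k F n * n%:R^-1.
  by rewrite -sumrB; apply: eq_bigr => n _; ring.
apply: le_trans (ler_normB _ _) _; rewrite ln1r in h1.
move: h1 h2; rewrite add0r divr1 invr1 !mulr1; lra.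
Qed.

(** Take [a = vonMangoldt] in the approximation: the divisor sums become [ln n], and the error is
    [C / N.+1] times [chebyshev_psi N], bounded by Chebyshev. *)
Lemma Psum_Llimit_le F (LF : G -> R) (C : R) N :
  \sum_v F v = 0 ->
  (forall u M, `|Lsum k (shift k u F) M - LF u| <= C / M.+1%:R) ->
  `|Psum LF N| <= 4 * l1norm k F + 8 * C.
Proof.
move=> F0 hL; have C0 : 0 <= C.
  by have := le_trans (normr_ge0 _) (hL 1%g 0%N); rewrite divr1.
have h1 := sum_zext_divisor_sum_approx vonMangoldt F LF C N hL.
have h2 := sum_zext_ln_le F N F0.
have e : \sum_(1 <= n < N.+1) zext k F n / n%:R *
    \sum_(1 <= d < n.+1 | (d %| n)%N) vonMangoldt d =
  \sum_(1 <= n < N.+1) zext k F n / n%:R * ln n%:R.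
  by apply: eq_big_nat => n /andP[n0 _]; rewrite divisor_sum_vonMangoldt.
rewrite e -/(Psum LF N) in h1.
have e2 : \sum_(1 <= d < N.+1) `|vonMangoldt d| = chebyshev_psi N.
  by apply: eq_bigr => d _; rewrite ger0_norm ?vonMangoldt_ge0.
rewrite e2 in h1.
have h3 : C / N.+1%:R * chebyshev_psi N <= 8 * C.
  rewrite mulrAC ler_pdivrMr ?ltr0n // [8 * C]mulrC -mulrA ler_wpM2l //.
  by apply: le_trans (chebyshev_psi_le N) _; rewrite ler_pM2l ?ltr0n // ler_nat.
move: (le_trans h1 h3) h2; rewrite !ler_norml => /andP[? ?] /andP[? ?].
by apply/andP; split; lra.
Qed.

(** Take the weights of [divisor_sum_mobius_ln] and the limit function 0. The term [n = 1] yields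
    [F 1 * ln N], and [sum_ln_ratio] bounds the total weight by [N]. *)
Lemma Psum_Lvanish_le F (C : R) N : (0 < N)%N ->
  (forall u M, `|Lsum k (shift k u F) M| <= C / M.+1%:R) ->
  `|Psum F N + F 1%g * ln N%:R| <= C.
Proof.
move=> N0 hL; have C0 : 0 <= C.
  by have := le_trans (normr_ge0 _) (hL 1%g 0%N); rewrite divr1.
have := sum_zext_divisor_sum_approx (fun d => mobius d * (ln N%:R - ln d%:R))
  F (fun=> 0) C N.
rewrite [X in _ - X]big1 => [|d _]; last by rewrite /zext; case: insub => *; rewrite mulr0.
rewrite subr0.
have -> : \sum_(1 <= n < N.+1) zext k F n / n%:R *
    \sum_(1 <= d < n.+1 | (d %| n)%N) mobius d * (ln N%:R - ln d%:R) =
    Psum F N + F 1%g * ln N%:R.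
  rewrite (eq_big_nat _ _ (F2 := fun n => vonMangoldt n / n%:R * zext k F n
     + (n == 1)%:R * (zext k F n / n%:R * ln N%:R))); last first.
    by move=> n /andP[n0 _]; rewrite divisor_sum_mobius_ln //; ring.
  rewrite big_split /= -/(Psum F N); congr (_ + _).
  rewrite big_ltn //= big_nat_cond big1 ?addr0 ?mul1r ?zext1 ?divr1 //.
  by move=> n /andP[/andP[n1 _] _]; rewrite gtn_eqF // mul0r.
move=> /(_ (fun u M => _)) h; apply: le_trans (h _) _.
  by move=> u M; rewrite subr0.
rewrite mulrAC ler_pdivrMr ?ltr0n // ler_wpM2l //.
apply: le_trans (_ : N%:R <= _); last by rewrite ler_nat.
apply: le_trans (sum_ln_ratio N).
rewrite big_nat_cond [X in _ <= X]big_nat_cond.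
apply: ler_sum => d /andP[/andP[d0 dN] _]; rewrite normrM.
have h2 : 0 <= ln N%:R - ln d%:R by rewrite subr_ge0 ler_ln_nat.
by rewrite (ger0_norm h2) -[X in _ <= X]mul1r ler_wpM2r // mobius_norm_le1.
Qed.

Lemma zext_cst_mul d m :
  zext k (fun=> 1) (d * m) = zext k (fun=> 1) d * zext k (fun=> 1) m.
Proof.
rewrite zext_mul [X in _ = X * _]/zext; case: insub => [u|]; last by rewrite mul0r.
by rewrite mul1r.
Qed.

Lemma zext_cst_bound n : 0 <= zext k (fun=> 1) n <= 1.
Proof. by rewrite /zext; case: insub => [_|]; rewrite ?lexx ?ler01. Qed.

(** [kappa] is the density [phi(q) / q] of the integers coprime to [q]; the deviation from it is
    periodic of mean 0, so its partial sums are bounded. *)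
Lemma sum_zext_cst_approx : exists2 kappa : R, 0 < kappa &
  exists B : R, forall M, `|\sum_(1 <= m < M.+1) zext k (fun=> 1) m - kappa * M%:R| <= B.
Proof.
set kappa : R := #|{: G}|%:R / q%:R.
have qn0 : q%:R != 0 :> R by rewrite pnatr_eq0.
exists kappa.
  by rewrite divr_gt0 ?ltr0n //; apply/card_gt0P; exists 1%g.
set h := fun n => zext k (fun=> 1) n - kappa.
exists (\sum_(0 <= r < q) `|h r| + `|h 0%N|) => M.
have hs : \sum_(0 <= r < q) h r = 0.
  rewrite sumrB sum_zext sumr_const sumr_const_nat subn0.
  by rewrite -(mulr_natr kappa) divfK // subrr.
have := periodic_partial_sum_le h q M.+1 isT
  (fun n => congr1 (fun x => x - kappa) (zext_period k _ n)) hs.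
rewrite big_ltn // => h1.
have -> : \sum_(1 <= m < M.+1) zext k (fun=> 1) m - kappa * M%:R =
    (h 0%N + \sum_(1 <= i < M.+1) h i) - h 0%N.
  rewrite [h 0%N + _]addrC addrK sumrB sumr_const_nat subn1 /=.
  by rewrite mulr_natr.
by apply: le_trans (ler_normB _ _) _; rewrite lerD2r.
Qed.

(** Mertens' first theorem for integers coprime to [q]. The sum [E] of their logarithms is evaluated
    twice: through [vonMangoldt] it is [ka * N * Psum + O(N)], directly it is
    [ka * N * ln N + O(N)]. *)
Lemma Psum_cst_approx : exists C : R, forall N, (0 < N)%N ->
  `|Psum (fun=> 1) N - ln N%:R| <= C.
Proof.
have [ka ka0 [B hB]] := sum_zext_cst_approx.
have B0 : 0 <= B := le_trans (normr_ge0 _) (hB 0%N).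
(* The three summands are the errors [h1] (Chebyshev), [h2] (replacing [ln n] by [ln N]) and [h3]
   (counting coprime integers), each divided by [N]. *)
exists ((8 * (B + ka) + 1 + B) / ka) => N N0.
have Np : 0 < N%:R :> R by rewrite ltr0n.
rewrite ler_pdivlMr // -(@ler_pM2r _ N%:R) //.
set z := zext k (fun=> 1).
set A := fun M => \sum_(1 <= m < M.+1) z m.
set E := \sum_(1 <= n < N.+1) z n * ln n%:R.
have E1 : E = \sum_(1 <= d < N.+1) vonMangoldt d * z d * A (N %/ d)%N.
  rewrite /E (eq_big_nat _ _ (F2 := fun n => \sum_(1 <= d < n.+1 | (d %| n)%N)
     (fun d m => vonMangoldt d * z d * z m) d (n %/ d)%N)); last first.
    move=> n /andP[n0 _]; rewrite -divisor_sum_vonMangoldt // mulr_sumr.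
    apply: eq_bigr => d dn; rewrite -{1}(divnK dn) mulnC /z zext_cst_mul; ring.
  rewrite (dirichlet_hyperbola (fun d m => vonMangoldt d * z d * z m)).
  by apply: eq_bigr => d _; rewrite mulr_sumr.
have h1 : `|E - ka * N%:R * Psum (fun=> 1) N| <= (B + ka) * (8 * N%:R).
  apply: le_trans (_ : (B + ka) * chebyshev_psi N <= _); last first.
    by rewrite ler_wpM2l ?chebyshev_psi_le // addr_ge0 // ltW.
  rewrite E1 /Psum mulr_sumr -sumrB mulr_sumr.
  apply: le_trans (ler_norm_sum _ _ _) _.
  rewrite big_nat_cond [X in _ <= X]big_nat_cond.
  apply: ler_sum => d /andP[/andP[d0 dN] _].
  have dp : 0 < d%:R :> R by rewrite ltr0n.
  have -> : vonMangoldt d * z d * A (N %/ d)%N -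
    ka * N%:R * (vonMangoldt d / d%:R * zext k (fun=> 1) d) =
    vonMangoldt d * (z d * (A (N %/ d)%N - ka * (N%:R / d%:R))) by rewrite -/z; ring.
  rewrite normrM (ger0_norm (vonMangoldt_ge0 d)) mulrC ler_wpM2r ?vonMangoldt_ge0 //.
  have /andP[z0 z1] : 0 <= z d <= 1 := zext_cst_bound d.
  rewrite normrM (ger0_norm z0) -[X in _ <= X]mul1r ler_pM ?normr_ge0 //.
  have hA := hB (N %/ d)%N; rewrite -/z -/(A _) in hA.
  have f1 : (N %/ d)%:R <= N%:R / d%:R :> R.
    by rewrite ler_pdivlMr // -natrM ler_nat leq_trunc_div.
  have f2 : N%:R / d%:R <= (N %/ d)%:R + 1 :> R.
    rewrite ler_pdivrMr // natr1 -natrM ler_nat ltnW //.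
    exact: ltn_ceil.
  have f3 : ka * (N %/ d)%:R <= ka * (N%:R / d%:R) by rewrite ler_wpM2l // ltW.
  have f4 : ka * (N%:R / d%:R) <= ka * (N %/ d)%:R + ka.
    by rewrite -[X in _ + X]mulr1 -mulrDr ler_wpM2l // ltW.
  move: hA; rewrite !ler_norml => /andP[? ?]; apply/andP; split; lra.
have h2 : `|A N * ln N%:R - E| <= N%:R.
  have e : A N * ln N%:R - E = \sum_(1 <= n < N.+1) z n * (ln N%:R - ln n%:R).
    by rewrite /A mulr_suml -sumrB; apply: eq_bigr => n _; ring.
  rewrite e; apply: le_trans (ler_norm_sum _ _ _) _; apply: le_trans (sum_ln_ratio N).
  rewrite big_nat_cond [X in _ <= X]big_nat_cond.
  apply: ler_sum => d /andP[/andP[d0 dN] _].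
  have hl : 0 <= ln N%:R - ln d%:R by rewrite subr_ge0 ler_ln_nat.
  have /andP[z0 z1] : 0 <= z d <= 1 := zext_cst_bound d.
  by rewrite normrM (ger0_norm hl) (ger0_norm z0) -[X in _ <= X]mul1r ler_wpM2r.
have h3 : `|A N * ln N%:R - ka * N%:R * ln N%:R| <= B * N%:R.
  rewrite -mulrBl normrM ler_pM ?normr_ge0 ?hB // ger0_norm ?ln_nat_ge0 //.
  by have := ln_le_subr1 N%:R Np; lra.
have -> : `|Psum (fun=> 1) N - ln N%:R| * ka * N%:R =
  `|(ka * N%:R * Psum (fun=> 1) N - ka * N%:R * ln N%:R)|.
  by rewrite -mulrBr normrM (ger0_norm (mulr_ge0 (ltW ka0) (ltW Np))); ring.
move: h1 h2 h3; rewrite !ler_norml => /andP[? ?] /andP[? ?] /andP[? ?].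
by apply/andP; split; lra.
Qed.

End MertensEstimates.

(** * Limit points of the distribution of primes *)

(* If a limiting distribution [rho] of the primes over the classes misses the
   class [a], the relation below forces [1 - #|gT| * rho] to be a real character. *)
Lemma density_character (gT : finGroupType) (rho : gT -> R) (a : gT) :
  (forall u v : gT, (u * v = v * u)%g) ->
  (forall u, 0 <= rho u) -> \sum_u rho u = 1 -> rho a = 0 ->
  (forall c, #|{: gT}|%:R * (\sum_g rho g * rho (g^-1 * c)%g + rho c) = 2) ->
  exists chi : gT -> R,
  [/\ forall u, chi u = 1 \/ chi u = -1,
      forall u v, chi (u * v)%g = chi u * chi v,
      \sum_u chi u = 0 & \sum_u rho u * chi u = -1].
Proof.
move=> mulC rho0 rho1 rhoa; set n : R := #|{: gT}|%:R => hrel.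
pose chi u := 1 - n * rho u; exists chi.
have np : 0 < n by rewrite ltr0n; apply/card_gt0P; exists 1%g.
have conv_ge0 c : 0 <= \sum_g rho g * rho (g^-1 * c)%g.
  by apply: sumr_ge0 => g _; rewrite mulr_ge0.
have rho_le c : n * rho c <= 2.
  by have := hrel c; have := mulr_ge0 (ltW np) (conv_ge0 c); lra.
(* At [c = a], where [rho] vanishes, the average of [n * rho (g^-1 * a)] against [rho] attains the
   upper bound 2, so equality holds termwise on the support of [rho]. *)
have tight : \sum_g rho g * (2 - n * rho (g^-1 * a)%g) = 0.
  transitivity (2 * \sum_g rho g - n * \sum_g rho g * rho (g^-1 * a)%g).
    by rewrite !mulr_sumr -sumrB; apply: eq_bigr => g _; ring.
  by have := hrel a; rewrite rhoa addr0 rho1 => ->; lra.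
have tight0 g : rho g * (2 - n * rho (g^-1 * a)%g) = 0.
  apply/eqP; move/eqP: tight; rewrite psumr_eq0; last first.
    by move=> i _; rewrite mulr_ge0 // subr_ge0.
  by move=> /allP /(_ g); rewrite mem_index_enum => /(_ isT).
(* The map [g -> g^-1 * a] is an involution; applying the equality case twice returns to [g]. *)
have dich g : rho g = 0 \/ n * rho g = 2.
  have [->|/eqP rg] := eqVneq (rho g) 0; [by left | right].
  have step h : rho h <> 0 -> n * rho (h^-1 * a)%g = 2.
    by move=> /eqP rh; have /eqP := tight0 h; rewrite mulf_eq0 (negbTE rh) /= subr_eq0 => /eqP.
  have := step _ rg => e1; have := step (g^-1 * a)%g.
  have -> : ((g^-1 * a)^-1 * a = g)%g by rewrite invMg invgK mulC mulKVg.
  by apply=> e0; move: e1; rewrite e0 mulr0; lra.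
have chi_pm u : chi u = 1 \/ chi u = -1.
  rewrite /chi; case: (dich u) => ->; [left | right]; lra.
have chi_sum : \sum_u chi u = 0.
  by rewrite sumrB sumr_const -mulr_sumr rho1 mulr1 -/n subrr.
have rhoE u : rho u = (1 - chi u) / n.
  by rewrite /chi; field; rewrite gt_eqF.
(* In terms of [chi], the relation says that the convolution of [chi] with itself is [n * chi]. *)
have conv_chi c : \sum_g (chi c - chi g * chi (g^-1 * c)%g) = 0.
  have s1 : \sum_g chi (g^-1 * c)%g = 0.
    by rewrite -[RHS]chi_sum [RHS](reindex_inj (inj_comp (mulIg c) invg_inj)).
  have : \sum_g (1 - chi g - chi (g^-1 * c)%g + chi g * chi (g^-1 * c)%g)
      = n * (1 + chi c).
    have -> : 1 + chi c = n * \sum_g rho g * rho (g^-1 * c)%g.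
      by have := hrel c; rewrite /chi; lra.
    rewrite !mulr_sumr; apply: eq_bigr => g _; rewrite !rhoE; field.
    by rewrite gt_eqF.
  rewrite big_split sumrB sumrB /= chi_sum s1 sumr_const -/n => h.
  rewrite sumrB sumr_const -(mulr_natl (chi c)) -/n; lra.
have chiM u v : chi (u * v)%g = chi u * chi v.
  (* Multiplied by the sign [chi c], every term is 1 minus a product of signs, hence nonnegative; as
     the sum is 0, all terms vanish. *)
  have main c : forall g, chi c - chi g * chi (g^-1 * c)%g = 0.
    have key : \sum_g chi c * (chi c - chi g * chi (g^-1 * c)%g) = 0.
      by rewrite -mulr_sumr conv_chi mulr0.
    have nonneg g : 0 <= chi c * (chi c - chi g * chi (g^-1 * c)%g).
      case: (chi_pm c) => ->; case: (chi_pm g) => ->; case: (chi_pm (g^-1 * c)%g) => ->; lra.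
    move=> g; move/eqP: key; rewrite psumr_eq0 // => /allP /(_ g).
    rewrite mem_index_enum => /(_ isT) /=; rewrite mulf_eq0 => /orP[/eqP|/eqP //].
    by case: (chi_pm c) => ->; lra.
  by have /eqP := main (u * v)%g u; rewrite mulKg subr_eq0 => /eqP.
split=> //.
have -> : \sum_u rho u * chi u = \sum_u (chi u - 1) / n.
  apply: eq_bigr => u _; rewrite rhoE; case: (chi_pm u) => ->; ring.
rewrite -mulr_suml sumrB chi_sum sumr_const -/n sub0r mulNr divff //.
by rewrite gt_eqF.
Qed.

(** [n <= f n] stands in for strict monotonicity: it suffices to send [f] to infinity. [f n] picks
    an index where [s] is within [1 / n.+1] of a cluster point. *)
Lemma bounded_seq_cvg_subseq (s : nat -> R) (B : R) :
  (forall n, 0 <= s n <= B) ->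
  exists f : nat -> nat, (forall n, (n <= f n)%N) /\ exists l : R, is_lim_seq (s \o f) l.
Proof.
move=> hs; have := Bolzano_Weierstrass s (fun x => Rle 0 x /\ Rle x B) (compact_P3 0 B).
case=> [n|l hl].
  by case/andP: (hs n) => /RleP ? /RleP ?.
have hex n : exists p, (n <= p)%N && (`|s p - l| < n.+1%:R^-1).
  have np : 0 < n.+1%:R^-1 :> R by rewrite invr_gt0 ltr0n.
  have dn : (fun x => Rlt (Rabs (x - l)) n.+1%:R^-1) l.
    by rewrite Rminus_diag Rabs_R0; apply/RltP.
  have nb : neighbourhood (fun x => Rlt (Rabs (x - l)) n.+1%:R^-1) l.
    by exists (mkposreal _ (RltP np)).
  have [p [hp1 hp2]] := hl _ n nb.
  exists p; apply/andP; split; first by apply/ssrnat.leP.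
  by apply/RltP; rewrite -RabsE -RminusE.
exists (fun n => xchoose (hex n)); split.
  by move=> n; case/andP: (xchooseP (hex n)).
exists l; apply/is_lim_seq_spec => e.
have e0 : 0 < pos e by apply/RltP; exact: cond_pos.
exists (Num.bound (e : R)^-1) => n hn.
case/andP: (xchooseP (hex n)) => _ h; apply/RltP; rewrite RabsE RminusE /=.
apply: lt_trans h _; rewrite -[X in _ < X]invrK ltf_pV2 ?posrE ?ltr0n ?invr_gt0 //.
apply: lt_le_trans (archi_boundP _) _; first by rewrite invr_ge0 ltW.
by rewrite ler_nat; lia.
Qed.

(** Extraction one index of [T] at a time; limits already obtained survive further extraction. *)
Lemma bounded_family_cvg_subseq (T : finType) (s : T -> nat -> R) (B : R) :
  (forall t n, 0 <= s t n <= B) ->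
  exists f : nat -> nat, (forall n, (n <= f n)%N) /\
    exists l : T -> R, forall t, is_lim_seq (s t \o f) (l t).
Proof.
move=> hs.
suff [f [hf h]] : exists f : nat -> nat, (forall n, (n <= f n)%N) /\
    forall t, t \in enum T -> exists l : R, is_lim_seq (s t \o f) l.
  exists f; split=> //.
  have h' t : exists l : R, is_lim_seq (s t \o f) l by apply: h; rewrite mem_enum.
  exact: fin_all_exists h'.
elim: (enum T) => [|t r [f [hf IH]]]; first by exists id; split.
have [g [hg [l hl]]] := bounded_seq_cvg_subseq (s t \o f) B (fun n => hs t (f n)).
exists (f \o g); split=> [n|t']; first by rewrite (leq_trans (hg n)) //= hf.
rewrite inE => /orP[/eqP -> | ht]; first by exists l.
have [l' hl'] := IH t' ht; exists l'.
apply: (is_lim_seq_subseq (s t' \o f) l' g) hl'.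
move=> P [N hN]; exists N => n Nn; apply: hN.
by have := hg n; lia.
Qed.

(** * Nonvanishing for real characters *)

Section RealCharacter.
Variable k : nat.
Local Notation q := k.+2.
Local Notation G := {unit 'I_q}.
Variable chi : G -> R.
Hypothesis chi_pm : forall u, chi u = 1 \/ chi u = -1.
Hypothesis chiM : forall u v, chi (u * v)%g = chi u * chi v.
Local Notation z := (zext k chi).

Lemma zext_charM d n : z (d * n) = z d * z n.
Proof.
rewrite zext_mul [X in _ = X * _]/zext; case: insub => [u|]; last by rewrite mul0r.
rewrite /zext; case: insub => [v|]; last by rewrite mulr0.
by rewrite /shift chiM.
Qed.

Lemma zext_char1 : z 1 = 1.
Proof.
rewrite zext1; have := chiM 1%g 1%g; rewrite mulg1.
by case: (chi_pm 1%g) => ->; lra.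
Qed.

Lemma zext_char_cases n : [\/ z n = 1, z n = -1 | z n = 0].
Proof.
rewrite /zext; case: insub => [u|]; last by constructor 3.
by case: (chi_pm u) => ->; [constructor 1 | constructor 2].
Qed.

Definition rsum (n : nat) : R := \sum_(1 <= d < n.+1 | (d %| n)%N) z d.

Lemma rsum_mulp p n : prime p -> (0 < n)%N -> 
  rsum (p * n) = \sum_(1 <= d < n.+1 | (d %| n)%N && ~~ (p %| d)%N) z d + z p * rsum n.
Proof.
move=> pp n0; rewrite /rsum divisor_sum_prime //; congr (_ + _).
by rewrite mulr_sumr; apply: eq_bigr => d _; rewrite zext_charM.
Qed.

Lemma coprime_divisor_sum (F : nat -> R) p j m : prime p -> coprime p m -> (0 < m)%N ->
  \sum_(1 <= d < (p ^ j * m).+1 | (d %| p ^ j * m)%N && ~~ (p %| d)%N) F d =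
  \sum_(1 <= d < m.+1 | (d %| m)%N) F d.
Proof.
move=> pp cop m0; have pj0 : (0 < p ^ j)%N by rewrite expn_gt0 prime_gt0.
rewrite (big_cat_nat (n := m.+1)) //= ?ltnS ?leq_pmull //.
have iff d : ((d %| p ^ j * m)%N && ~~ (p %| d)%N) = (d %| m)%N.
  apply/andP/idP => [[h1 h2]|h].
    by move: h1; rewrite Gauss_dvdr // coprimeXr // coprime_sym prime_coprime.
  split; first by rewrite dvdn_mull.
  apply/negP => pd; move: cop; rewrite prime_coprime //.
  by rewrite (dvdn_trans pd h).
rewrite [X in _ + X]big_nat_cond [X in _ + X]big1 ?addr0.
  by apply: eq_bigl => d; rewrite iff.
move=> d /andP[/andP[md _]]; rewrite iff => /(dvdn_leq m0).
by rewrite leqNgt md.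
Qed.

Lemma rsum_pfactor p j m : prime p -> coprime p m -> (0 < m)%N ->
  rsum (p ^ j.+1 * m) = rsum m + z p * rsum (p ^ j * m).
Proof.
move=> pp cop m0; have pj0 : (0 < p ^ j * m)%N by rewrite muln_gt0 expn_gt0 prime_gt0.
by rewrite expnS -mulnA rsum_mulp // coprime_divisor_sum.
Qed.

(** [rsum] is the convolution of 1 and [chi]. The prime power [p^l] exactly dividing [n] contributes
    the factor [1 + z p + ... + (z p)^l], which is nonnegative, and at least 1 for even [l]. In a
    square all exponents are even. *)
Lemma rsum_lower n : (0 < n)%N ->
  0 <= rsum n /\ (forall j, n = (j * j)%N -> 1 <= rsum n).
Proof.
have [b] := ubnP n; elim: b n => // b IH n nb n0.
have [n1|n1] := leqP n 1.
  have -> : n = 1%N by lia.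
  have -> : rsum 1 = 1 by rewrite /rsum big_mkcond big_nat1 /= zext_char1.
  by rewrite ler01 lexx.
have pp := pdiv_prime n1; set p := pdiv n in pp.
have [m cop e] := pfactor_coprime pp n0; set l := logn p n in e.
have l0 : (0 < l)%N by rewrite logn_gt0 mem_primes pp n0 pdiv_dvd.
have m0 : (0 < m)%N by case: m e {cop} => //; rewrite mul0n; lia.
have p1 := prime_gt1 pp.
have pl1 : (1 < p ^ l)%N by rewrite -(expn0 p) ltn_exp2l.
have mn : (m < b)%N by nia.
have [r0 r1] := IH m mn m0.
have step j : rsum (p ^ j * m) = rsum m * \sum_(i < j.+1) z p ^+ i.
  elim: j => [|j IHj]; first by rewrite expn0 mul1n big_ord1 expr0 mulr1.
  rewrite rsum_pfactor // IHj [in RHS]big_ord_recl expr0 mulrDr mulr1; congr (_ + _).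
  by rewrite mulrCA; congr (_ * _); rewrite mulr_sumr; apply: eq_bigr => i _; rewrite -exprS.
(* For [z p] equal to 1, -1, 0 the sum is [j + 1], the indicator of even [j], and 1. *)
have geo j : 0 <= \sum_(i < j.+1) z p ^+ i /\
    (~~ odd j -> 1 <= \sum_(i < j.+1) z p ^+ i).
  have [z1|z1|z1] := zext_char_cases p; rewrite z1.
  - have -> : \sum_(i < j.+1) 1 ^+ i = j.+1%:R :> R.
      by rewrite (eq_bigr (fun=> 1)) ?sumr_const ?card_ord // => i _; rewrite expr1n.
    by rewrite ler0n ler1n.
  - have -> : \sum_(i < j.+1) (-1) ^+ i = (~~ odd j)%:R :> R.
      elim: j => [|j IHj]; first by rewrite big_ord1 expr0.
      rewrite big_ord_recr /= IHj negbK -signr_odd /=.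
      by case: (odd j); rewrite /= ?expr0 ?expr1; lra.
    by case: (odd j) => /=; split => //; lra.
  - have -> : \sum_(i < j.+1) 0 ^+ i = 1 :> R.
      by rewrite big_ord_recl expr0 big1 ?addr0 // => i _; rewrite exprS mul0r.
    by split; lra.
have [g0 g1] := geo l.
have nE : rsum n = rsum m * \sum_(i < l.+1) z p ^+ i by rewrite -step mulnC -e.
rewrite nE; split; first exact: mulr_ge0.
move=> j ej; have j0 : (0 < j)%N by case: j ej => // ej; lia.
have lj : l = (logn p j).*2 by rewrite /l ej lognM // addnn.
have [m' cop' e'] := pfactor_coprime pp j0.
(* The cofactor of a square is again a square, so the induction hypothesis applies. *)
have em : m = (m' * m')%N.
  have pp0 : (0 < p ^ l)%N by lia.
  apply/eqP; rewrite -(eqn_pmul2r pp0) -e ej {1 2}e' lj -addnn expnD; apply/eqP.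
  ring.
have := r1 _ em; have := g1; rewrite lj odd_double => /(_ isT); rewrite -lj => h1 h2.
by rewrite -[1]mulr1 ler_pM.
Qed.

End RealCharacter.

(** * Sums of inverse square roots *)

Lemma sqrt_natS_bounds (n : nat) (a := Num.sqrt n%:R : R) (b := Num.sqrt n.+1%:R : R) :
  [/\ 0 <= a, 0 < b, a <= b, b ^+ 2 = a ^+ 2 + 1 & a ^+ 2 = n%:R].
Proof.
have a2 : a ^+ 2 = n%:R by rewrite sqr_sqrtr ?ler0n.
have b2 : b ^+ 2 = n.+1%:R by rewrite sqr_sqrtr ?ler0n.
split=> //; [exact: sqrtr_ge0 | by rewrite sqrtr_gt0 ltr0n | | by rewrite a2 b2 natr1].
by rewrite ler_sqrt ?ler0n // ler_nat.
Qed.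

Definition inv_sqrt_sum (M : nat) : R := \sum_(1 <= m < M.+1) (Num.sqrt m%:R)^-1.

Lemma inv_sqrt_sumS M :
  inv_sqrt_sum M.+1 = inv_sqrt_sum M + (Num.sqrt M.+1%:R)^-1.
Proof. by rewrite /inv_sqrt_sum big_nat_recr. Qed.

Lemma inv_sqrt_sum_upper_antitone M N : (M <= N)%N ->
  inv_sqrt_sum N - 2 * Num.sqrt N%:R <= inv_sqrt_sum M - 2 * Num.sqrt M%:R.
Proof.
elim: N => [|N IH]; first by rewrite leqn0 => /eqP ->.
rewrite leq_eqVlt => /orP[/eqP -> //|]; rewrite ltnS => /IH h.
apply: le_trans h; rewrite inv_sqrt_sumS.
have [a0 b0 ab b2 _] := sqrt_natS_bounds N.
have : (Num.sqrt N.+1%:R)^-1 <= 2 * (Num.sqrt N.+1%:R - Num.sqrt N%:R) :> R.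
  rewrite -[X in X <= _]mul1r ler_pdivrMr //; nra.
lra.
Qed.

Lemma inv_sqrt_sum_lower_monotone M N : (M <= N)%N ->
  inv_sqrt_sum M - 2 * Num.sqrt M.+1%:R <= inv_sqrt_sum N - 2 * Num.sqrt N.+1%:R.
Proof.
elim: N => [|N IH]; first by rewrite leqn0 => /eqP ->.
rewrite leq_eqVlt => /orP[/eqP -> //|]; rewrite ltnS => /IH h.
apply: le_trans h _; rewrite inv_sqrt_sumS.
have [_ a0 _ _ _] := sqrt_natS_bounds N.
have [_ b0 ab b2 _] := sqrt_natS_bounds N.+1.
have : 2 * (Num.sqrt N.+2%:R - Num.sqrt N.+1%:R) <= (Num.sqrt N.+1%:R)^-1 :> R.
  rewrite -[X in _ <= X]mul1r ler_pdivlMr //; nra.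
lra.
Qed.

(** [kappa], in fact [zeta(1/2)], is trapped between the increasing and the decreasing sequence
    above, whose gap is [2 (sqrt (M + 1) - sqrt M)]. A real [y] is allowed because [X / d] will be
    inserted. *)
Lemma inv_sqrt_sum_approx : exists kappa : R, forall (M : nat) (y : R),
  0 < y -> M%:R <= y <= M.+1%:R ->
  `|inv_sqrt_sum M - 2 * Num.sqrt y - kappa| <= 2 / Num.sqrt y.
Proof.
have ut M N : inv_sqrt_sum M - 2 * Num.sqrt M.+1%:R <= inv_sqrt_sum N - 2 * Num.sqrt N%:R.
  apply: le_trans (inv_sqrt_sum_lower_monotone _ _ (leq_maxl M N)) _.
  apply: le_trans _ (inv_sqrt_sum_upper_antitone _ _ (leq_maxr M N)).
  by have [_ _ ab _ _] := sqrt_natS_bounds (maxn M N); lra.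
pose E (x : R) := exists M, x = inv_sqrt_sum M - 2 * Num.sqrt M.+1%:R.
have [||kappa [hub hlub]] := completeness E.
- exists (inv_sqrt_sum 0 - 2 * Num.sqrt 0%:R) => x [M ->]; exact/RleP.
- by exists (inv_sqrt_sum 0 - 2 * Num.sqrt 1%:R), 0%N.
exists kappa => M y y0 /andP[My yM].
have h1 : inv_sqrt_sum M - 2 * Num.sqrt M.+1%:R <= kappa by apply/RleP/hub; exists M.
have h2 : kappa <= inv_sqrt_sum M - 2 * Num.sqrt M%:R.
  by apply/RleP/hlub => x [N ->]; exact/RleP.
have [a0 b0 ab b2 _] := sqrt_natS_bounds M.
have ya : Num.sqrt M%:R <= Num.sqrt y by rewrite ler_sqrt // ltW.
have yb : Num.sqrt y <= Num.sqrt M.+1%:R by rewrite ler_sqrt // ler0n.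
have sy0 : 0 < Num.sqrt y by rewrite sqrtr_gt0.
have h3 : 2 * (Num.sqrt M.+1%:R - Num.sqrt M%:R) <= 2 / Num.sqrt y.
  rewrite ler_pdivlMr //; nra.
rewrite ler_norml; apply/andP; split; lra.
Qed.

Lemma harmonic_ge_ln N : ln N.+1%:R <= \sum_(1 <= j < N.+1) j%:R^-1.
Proof.
elim: N => [|N IH]; first by rewrite big_geq // ln1r.
rewrite big_nat_recr //=; have := ln_natS N.+1.
rewrite mulrC -ler_pdivlMr ?ltr0n // mul1r => h.
by apply: le_trans (lerD IH h); rewrite addrC subrK.
Qed.

(** * The hyperbola method for the convolution of 1 and a real character *)

Section RealCharacterNonvanishing.
Variable k : nat.
Local Notation q := k.+2.
Local Notation G := {unit 'I_q}.
Variable chi : G -> R.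
Hypothesis chi_pm : forall u, chi u = 1 \/ chi u = -1.
Hypothesis chiM : forall u v, chi (u * v)%g = chi u * chi v.
Hypothesis chi_sum : \sum_u chi u = 0.
Local Notation z := (zext k chi).
Local Notation w n := ((Num.sqrt n%:R)^-1).

Lemma inv_sqrt_antitone (m n : nat) : (0 < m)%N -> (m <= n)%N -> w n <= w m :> R.
Proof.
move=> m0 mn; rewrite lef_pV2 ?posrE ?sqrtr_gt0 ?ltr0n //; last by lia.
by rewrite ler_sqrt ?ler0n // ler_nat.
Qed.

Lemma sum_zext_inv_sqrt_le (M N : nat) : (0 < M)%N -> (M <= N)%N ->
  `|\sum_(M <= d < N) z d * w d| <= 2 * l1norm k chi * w M.
Proof.
move=> M0 MN; apply: (abel_sum_le z (fun d => w d)) => //.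
- by move=> n; apply: zext_partial_sum_le.
- move=> n Mn; rewrite invr_ge0 sqrtr_ge0 inv_sqrt_antitone //; lia.
- by rewrite invr_ge0 sqrtr_ge0.
Qed.

(** Keep only the squares: [n = j^2] contributes at least [1 / j], and all other terms are
    nonnegative. *)
Lemma rsum_inv_sqrt_lower N :
  \sum_(1 <= j < N.+1) j%:R^-1 <= \sum_(1 <= n < (N * N).+1) rsum k chi n * w n.
Proof.
elim: N => [|N IH]; first by rewrite !big_geq.
rewrite big_nat_recr //= [X in _ <= X](big_cat_nat (n := (N * N).+1)) //=; last by lia.
apply: lerD IH _.
have e : (N.+1 * N.+1)%N = (N * N + N + N).+1 by lia.
rewrite e big_nat_recr /=; last by lia.
have h : 0 <= \sum_((N * N).+1 <= i < (N * N + N + N).+1) rsum k chi i * w i.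
  rewrite big_nat_cond; apply: sumr_ge0 => i /andP[/andP[i0 _] _].
  have [h _] := rsum_lower k chi chi_pm chiM i ltac:(lia).
  by rewrite mulr_ge0 // invr_ge0 sqrtr_ge0.
rewrite -e in h *.
have [_ /(_ N.+1 erefl) h2] := rsum_lower k chi chi_pm chiM (N.+1 * N.+1) ltac:(lia).
have e2 : Num.sqrt (N.+1 * N.+1)%:R = N.+1%:R :> R.
  by rewrite natrM -expr2 sqrtr_sqr ger0_norm ?ler0n.
rewrite e2; apply: le_trans (_ : rsum k chi (N.+1 * N.+1) * N.+1%:R^-1 <= _).
  by rewrite -[X in X <= _]mul1r ler_wpM2r ?invr_ge0 ?ler0n.
by rewrite lerDr.
Qed.

Lemma rsum_inv_sqrt_hyperbola X :
  \sum_(1 <= n < X.+1) rsum k chi n * w n =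
  \sum_(1 <= d < X.+1) z d * w d * inv_sqrt_sum (X %/ d).
Proof.
rewrite (eq_big_nat _ _ (F2 := fun n => \sum_(1 <= d < n.+1 | (d %| n)%N)
   (fun d m => z d * w d * w m) d (n %/ d)%N)); last first.
  move=> n /andP[n0 _]; rewrite /rsum mulr_suml; apply: eq_bigr => d dn.
  rewrite -mulrA -invfM -sqrtrM ?ler0n // -natrM [(d * _)%N]mulnC divnK //.
rewrite (dirichlet_hyperbola (fun d m => z d * w d * w m)).
by apply: eq_bigr => d _; rewrite mulr_sumr.
Qed.

(** If [d > N] and [d * m <= N^2], then [m <= N]; so the other order of summation has a short outer
    sum. *)
Lemma hyperbola_tail_swap (f g : nat -> R) N (X := (N * N)%N) :
  \sum_(N.+1 <= d < X.+1) f d * \sum_(1 <= m < (X %/ d).+1) g m =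
  \sum_(1 <= m < N.+1) g m * \sum_(N.+1 <= d < (X %/ m).+1) f d.
Proof.
transitivity (\sum_(N.+1 <= d < X.+1) \sum_(1 <= m < N.+1)
    (if (d * m <= X)%N then f d * g m else 0)).
  apply: eq_big_nat => d /andP[d0 _].
  rewrite (@big_nat_widen _ _ _ 1 (X %/ d).+1 N.+1); last first.
    by rewrite ltnS -(mulnK N (_ : 0 < d)%N) ?leq_div2r //; [rewrite leq_mul2l ltnW ?orbT | lia].
  rewrite mulr_sumr big_mkcond; apply: eq_bigr => m _.
  by rewrite ltnS leq_divRL 1?mulnC //; lia.
rewrite exchange_big_nat /=; apply: eq_big_nat => m /andP[m0 _].
rewrite (@big_nat_widen _ _ _ N.+1 (X %/ m).+1 X.+1) ?ltnS ?leq_div //.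
rewrite mulr_sumr [RHS]big_mkcond; apply: eq_bigr => d _.
by rewrite ltnS leq_divRL // mulrC.
Qed.

(** The excluded hypothesis is [L(1, chi) = 0] with its rate. It would bound the sum of
    [rsum n / sqrt n] over [n <= N^2] by a constant, while [rsum_inv_sqrt_lower] makes it at least
    [ln N.+1]. *)
Lemma real_character_Lsum_nonvanishing (C : R) :
  ~ (forall M, `|Lsum k chi M| <= C / M.+1%:R).
Proof.
move=> hL; have C0 : 0 <= C.
  by have := le_trans (normr_ge0 _) (hL 0%N); rewrite divr1.
have [kappa hk] := inv_sqrt_sum_approx.
set B := l1norm k chi; have B0 : 0 <= B := l1norm_ge0 k chi.
pose K := 4 * B + (2 * C + 2 * B * `|kappa| + 2).
have bound N : (0 < N)%N -> ln N.+1%:R <= K.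
  move=> N0; apply: le_trans (harmonic_ge_ln N) _.
  apply: le_trans (rsum_inv_sqrt_lower N) _; set X := (N * N)%N.
  have Np : 0 < N%:R :> R by rewrite ltr0n.
  rewrite rsum_inv_sqrt_hyperbola (big_cat_nat (n := N.+1)) //=; last by rewrite /X; nia.
  (* After the swap, the inner sums are at most [2 B / sqrt (N + 1)] by Abel summation, and the
     outer weights add up to at most [2 sqrt (N + 1)]. *)
  have T2 : `|\sum_(N.+1 <= d < X.+1) z d * w d * inv_sqrt_sum (X %/ d)| <= 4 * B.
    rewrite (hyperbola_tail_swap (fun d => z d * w d) (fun m => w m)).
    apply: le_trans (ler_norm_sum _ _ _) _.
    apply: le_trans (_ : \sum_(1 <= m < N.+1) w m * (2 * B * w N.+1) <= _).
      rewrite big_nat_cond [X in _ <= X]big_nat_cond.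
      apply: ler_sum => m /andP[/andP[m0 mN] _].
      rewrite normrM ger0_norm ?invr_ge0 ?sqrtr_ge0 // ler_wpM2l ?invr_ge0 ?sqrtr_ge0 //.
      apply: sum_zext_inv_sqrt_le => //.
      by rewrite ltnS leq_divRL // /X leq_mul2l -ltnS mN orbT.
    rewrite -mulr_suml -/(inv_sqrt_sum N).
    have := inv_sqrt_sum_upper_antitone 0 N (leq0n _).
    rewrite /inv_sqrt_sum [X in _ <= X - _]big_geq // sqrtr0 mulr0 subr0 -/(inv_sqrt_sum N) => h.
    have [a0 b0 ab _ _] := sqrt_natS_bounds N.
    have h2 : inv_sqrt_sum N <= 2 * Num.sqrt N.+1%:R by lra.
    apply: le_trans (ler_wpM2r _ h2) _.
      by rewrite !mulr_ge0 // invr_ge0 ltW.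
    have -> : 2 * Num.sqrt N.+1%:R * (2 * B * w N.+1) = 4 * B :> R; last by [].
    by field; rewrite gt_eqF.
  have T1 : `|\sum_(1 <= d < N.+1) z d * w d * inv_sqrt_sum (X %/ d)|
      <= 2 * C + 2 * B * `|kappa| + 2.
    pose er d := inv_sqrt_sum (X %/ d) - 2 * Num.sqrt (X%:R / d%:R) - kappa.
    (* Since [sqrt (X / d) = N / sqrt d], the leading part is [2 N] times [Lsum], which stays
       bounded exactly because the limit is assumed to be 0. *)
    have -> : \sum_(1 <= d < N.+1) z d * w d * inv_sqrt_sum (X %/ d) =
      2 * N%:R * Lsum k chi N + kappa * \sum_(1 <= d < N.+1) z d * w d +
      \sum_(1 <= d < N.+1) z d * w d * er d.
      rewrite /Lsum !mulr_sumr -!big_split /=; apply: eq_big_nat => d /andP[d0 _].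
      have sd : 0 < Num.sqrt d%:R :> R by rewrite sqrtr_gt0 ltr0n.
      have e1 : Num.sqrt (X%:R / d%:R) = N%:R / Num.sqrt d%:R :> R.
        rewrite sqrtrM ?ler0n // sqrtrV ?ler0n // /X natrM -expr2 sqrtr_sqr.
        by rewrite ger0_norm ?ler0n.
      have e2 : d%:R = Num.sqrt d%:R * Num.sqrt d%:R :> R.
        by rewrite -expr2 sqr_sqrtr ?ler0n.
      rewrite /er e1 [in X in _ = X + _ + _]e2; field.
      by rewrite gt_eqF.
    have h1 : `|2 * N%:R * Lsum k chi N| <= 2 * C.
      rewrite normrM (@ger0_norm _ (2 * N%:R)) ?mulr_ge0 ?ler0n //.
      apply: le_trans (ler_wpM2l _ (hL N)) _; first by rewrite mulr_ge0 ?ler0n.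
      rewrite mulrA ler_pdivrMr ?ltr0n // -natr1; nra.
    have h2 : `|kappa * \sum_(1 <= d < N.+1) z d * w d| <= 2 * B * `|kappa|.
      rewrite normrM mulrC ler_wpM2r //.
      apply: le_trans (sum_zext_inv_sqrt_le 1 N.+1 isT isT) _.
      by rewrite sqrtr1 invr1 mulr1.
    (* [er d] is at most [2 sqrt d / N]; the weight [w d] cancels the root and leaves [N] terms of
       size at most [2 / N]. *)
    have h3 : `|\sum_(1 <= d < N.+1) z d * w d * er d| <= 2.
      apply: le_trans (ler_norm_sum _ _ _) _.
      apply: le_trans (_ : \sum_(1 <= d < N.+1) 2 / N%:R <= _); last first.
        rewrite sumr_const_nat subn1 /= -[X in X <= _]mulr_natr divfK // gt_eqF //.
      rewrite big_nat_cond [X in _ <= X]big_nat_cond.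
      apply: ler_sum => d /andP[/andP[d0 dN] _].
      have dp : 0 < d%:R :> R by rewrite ltr0n.
      have sd : 0 < Num.sqrt d%:R :> R by rewrite sqrtr_gt0 ltr0n.
      have Xp : 0 < X%:R :> R by rewrite /X natrM mulr_gt0.
      have := hk (X %/ d)%N (X%:R / d%:R) (divr_gt0 Xp dp).
      rewrite ler_pdivlMr // -natrM ler_nat leq_trunc_div /=.
      rewrite ler_pdivrMr // -natrM ler_nat (ltnW (ltn_ceil _ d0)) => /(_ isT).
      rewrite -/(er d).
      have -> : Num.sqrt (X%:R / d%:R) = N%:R / Num.sqrt d%:R :> R.
        rewrite sqrtrM ?ler0n // sqrtrV ?ler0n // /X natrM -expr2 sqrtr_sqr.
        by rewrite ger0_norm ?ler0n.
      move=> h; rewrite -mulrA normrM.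
      have z1 : `|z d| <= 1.
        by case: (zext_char_cases k chi chi_pm d) => ->; rewrite ?normrN ?normr1 ?normr0 ?ler01.
      rewrite -[X in _ <= X]mul1r ler_pM ?normr_ge0 // normrM.
      rewrite (@ger0_norm _ (w d)) ?invr_ge0 ?(ltW sd) // mulrC ler_pdivrMr //.
      by apply: le_trans h _; rewrite invf_div mulrA mulrAC.
    apply: le_trans (ler_normD _ _) _; apply: lerD h3.
    by apply: le_trans (ler_normD _ _) _; apply: lerD.
  move: T1 T2; rewrite /K !ler_norml => /andP[? ?] /andP[? ?]; lra.
pose N := (Num.bound (exp (K + 1)%R)).+1.
have h : exp (K + 1)%R <= N.+1%:R.
  have e0 : 0 <= exp (K + 1)%R by apply/RleP; left; exact: exp_pos.
  apply: le_trans (ltW (archi_boundP e0)) _; rewrite ler_nat /N; lia.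
have e0 : 0 < exp (K + 1)%R by apply/RltP; exact: exp_pos.
have := ln_ler _ _ e0 h; rewrite ln_exp => h1.
by have := bound N isT; lra.
Qed.

End RealCharacterNonvanishing.

(** * Primes in arithmetic progressions *)

Lemma is_lim_seq_sum (T : finType) (c : T -> R) (s : T -> nat -> R) (l : T -> R) :
  (forall t, is_lim_seq (s t) (l t)) ->
  is_lim_seq (fun n => \sum_t c t * s t n) (\sum_t c t * l t).
Proof.
move=> hs; elim: (index_enum T) => [|t r IH].
  rewrite big_nil; apply: is_lim_seq_ext (is_lim_seq_const 0) => n.
  by rewrite big_nil.
rewrite big_cons.
apply: (is_lim_seq_ext (fun n => Rplus (c t * s t n) (\sum_(j <- r) c j * s j n))).
  by move=> n; rewrite big_cons.
apply: is_lim_seq_plus' => //.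
exact: (is_lim_seq_scal_l (s t) (c t) (l t) (hs t)).
Qed.

Lemma ln_nat_unbounded (K : R) : exists n0, forall n, (n0 <= n)%N -> K < ln n.+2%:R.
Proof.
exists (Num.bound (exp (K + 1)%R)) => n hn.
have e0 : 0 < exp (K + 1)%R by apply/RltP; exact: exp_pos.
have h : exp (K + 1)%R <= n.+2%:R.
  apply: le_trans (ltW (archi_boundP (ltW e0))) _; rewrite ler_nat; lia.
by have := ln_ler _ _ e0 h; rewrite ln_exp; lra.
Qed.

Section PrimesInClasses.
Variable k : nat.
Local Notation q := k.+2.
Local Notation G := {unit 'I_q}.
Implicit Types (F : G -> R) (u v : G).

Lemma eq_zext F F' n : F =1 F' -> zext k F n = zext k F' n.
Proof. by move=> e; rewrite /zext; case: insub. Qed.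

Lemma zext_sum (r : G -> R) (H : G -> G -> R) n :
  zext k (fun v => \sum_g r g * H g v) n = \sum_g r g * zext k (H g) n.
Proof.
rewrite /zext; case: insub => //.
by rewrite big1 // => g _; rewrite mulr0.
Qed.

Lemma Lsum_sum (r : G -> R) (H : G -> G -> R) F M :
  (forall v, F v = \sum_g r g * H g v) ->
  Lsum k F M = \sum_g r g * Lsum k (H g) M.
Proof.
move=> e; rewrite /Lsum; under [RHS]eq_bigr do rewrite mulr_sumr.
rewrite exchange_big /=; apply: eq_bigr => n _.
rewrite (eq_zext _ _ n e) zext_sum mulr_suml.
by apply: eq_bigr => g _; rewrite mulrA.
Qed.

Lemma eq_Lsum F F' M : F =1 F' -> Lsum k F M = Lsum k F' M.
Proof. by move=> e; apply: eq_bigr => n _; rewrite (eq_zext _ _ n e). Qed.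

Definition ind u : G -> R := fun v => (v == u)%:R.

Lemma sum_ind F u : \sum_v F v * ind u v = F u.
Proof.
rewrite (bigD1 u) //= /ind eqxx mulr1 big1 ?addr0 // => v /negbTE ->.
by rewrite mulr0.
Qed.

Lemma PsumE F N : Psum k F N = \sum_u F u * Psum k (ind u) N.
Proof.
have e v : F v = \sum_u F u * ind u v.
  rewrite -[LHS](sum_ind F); apply: eq_bigr => u _.
  by rewrite /ind eq_sym.
rewrite /Psum; under [RHS]eq_bigr do rewrite mulr_sumr.
rewrite exchange_big /=; apply: eq_bigr => n _.
rewrite (eq_zext _ _ n e) zext_sum mulr_sumr.
by apply: eq_bigr => g _; rewrite mulrCA.
Qed.

Lemma Psum_ind_ge0 u N : 0 <= Psum k (ind u) N.
Proof.
apply: sumr_ge0 => d _; rewrite mulr_ge0 ?divr_ge0 ?vonMangoldt_ge0 ?ler0n //.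
by rewrite /zext; case: insub => // v; rewrite /ind ler0n.
Qed.

(** [rho] is a subsequential limit of [Psum (ind u) / ln], bounded thanks to [Psum_cst_approx]. An
    estimate [Psum F N = c ln N + O(1)] holds for all [N], so it passes to any such limit. *)
Lemma limit_density : exists rho : G -> R,
  (forall u, 0 <= rho u) /\
  (forall F (c C : R), (forall N, (0 < N)%N -> `|Psum k F N - c * ln N%:R| <= C) ->
    \sum_u F u * rho u = c).
Proof.
have [C0 hC0] := Psum_cst_approx k.
have C00 : 0 <= C0 := le_trans (normr_ge0 _) (hC0 1%N isT).
have ln2 : 0 < ln 2%:R by apply: ln_pos.
have lnp n : 0 < ln n.+2%:R by apply: ln_pos.
(* The shift to [n.+2] keeps the denominator at least [ln 2]. *)
pose s u n := Psum k (ind u) n.+2 / ln n.+2%:R.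
have sB u n : 0 <= s u n <= 1 + C0 / ln 2%:R.
  rewrite divr_ge0 ?Psum_ind_ge0 ?ln_nat_ge0 //=.
  rewrite ler_pdivrMr // mulrDl mul1r.
  have h1 : Psum k (ind u) n.+2 <= Psum k (fun=> 1) n.+2.
    rewrite [X in _ <= X]PsumE (bigD1 u) //= mul1r lerDl sumr_ge0 // => v _.
    by rewrite mul1r Psum_ind_ge0.
  have h2 : C0 <= C0 / ln 2%:R * ln n.+2%:R.
    by rewrite -mulrA ler_peMr // mulrC ler_pdivlMr // mul1r ler_ln_nat.
  have := hC0 n.+2 isT; rewrite ler_norml => /andP[_ h3]; lra.
have [f [hf [rho hrho]]] := bounded_family_cvg_subseq G s _ sB.
exists rho; split=> [u|F c C h].
  have := is_lim_seq_le (fun=> 0 : R) (s u \o f) (Finite 0) (Finite (rho u)) _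
    (is_lim_seq_const 0) (hrho u).
  move=> h; apply/RleP/h => n; apply/RleP.
  by case/andP: (sB u (f n)).
have l1 := is_lim_seq_sum _ F _ _ hrho.
have l2 : is_lim_seq (fun n => \sum_u F u * (s u \o f) n) c.
  apply/is_lim_seq_spec => e.
  have e0 : 0 < pos e by apply/RltP; exact: cond_pos.
  have [n0 hn0] := ln_nat_unbounded (C / (e : R)).
  exists n0 => n hn; apply/RltP; rewrite RabsE RminusE.
  have -> : \sum_u F u * (s u \o f) n = Psum k F (f n).+2 / ln (f n).+2%:R.
    by rewrite PsumE mulr_suml; apply: eq_bigr => u _; rewrite /= /s mulrA.
  have lp := lnp (f n).
  have -> : Psum k F (f n).+2 / ln (f n).+2%:R - c =
      (Psum k F (f n).+2 - c * ln (f n).+2%:R) / ln (f n).+2%:R.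
    by field; rewrite gt_eqF.
  rewrite normrM normfV (gtr0_norm lp) ltr_pdivrMr //.
  apply: le_lt_trans (h (f n).+2 isT) _; rewrite mulrC -ltr_pdivrMr //.
  by apply: hn0; have := hf n; lia.
have := is_lim_seq_unique _ _ l1; rewrite (is_lim_seq_unique _ _ l2).
by case.
Qed.

(** Boundedness would force [rho a = 0]; the convolution relation [rel] then produces a real
    character with [rho(chi) = -1], for which [L(1, chi)] would vanish. *)
Lemma primes_in_class_unbounded (a : G) (C : R) :
  ~ (forall N, Psum k (ind a) N <= C).
Proof.
move=> hC.
have mulC u v : (u * v = v * u)%g by exact: unit_Zp_mulgC.
have [rho [rho0 rhoE]] := limit_density.
have rho1 : \sum_u rho u = 1.
  have [C0 hC0] := Psum_cst_approx k.
  rewrite -(rhoE (fun=> 1) 1 C0) => [|N N0]; last by rewrite mul1r hC0.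
  by apply: eq_bigr => u _; rewrite mul1r.
have rhoa : rho a = 0.
  rewrite -(rhoE (ind a) 0 C) => [|N N0].
    by rewrite -(sum_ind rho); apply: eq_bigr => u _; rewrite mulrC.
  by rewrite mul0r subr0 ger0_norm ?Psum_ind_ge0 ?hC.
pose n : R := #|{: G}|%:R.
have rel c : n * (\sum_g rho g * rho (g^-1 * c)%g + rho c) = 2.
  (* The indicator of [c], rescaled and corrected to have sum 0. *)
  pose F v := n * ind c v - 1.
  have F0 : \sum_v F v = 0.
    have s1 : \sum_v ind c v = 1.
      by rewrite -[RHS](sum_ind (fun=> 1) c); apply: eq_bigr => v _; rewrite mul1r.
    by rewrite sumrB -mulr_sumr s1 mulr1 sumr_const subrr.
  have [LF hLF] := Lsum_limit k F F0; set B := 2 * l1norm k F in hLF.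
  (* Every translate of [LF] is the limit function of a translate of [F], so its [Psum] is bounded
     and [rho] annihilates it. *)
  have LF0 x : \sum_g rho g * LF (x * g)%g = 0.
    rewrite -[RHS](rhoE (shift k x LF) 0 (4 * l1norm k (shift k x F) + 8 * B)).
      by apply: eq_bigr => u _; rewrite mulrC.
    move=> N N0; rewrite mul0r subr0; apply: Psum_Llimit_le.
      by rewrite sum_shift.
    move=> u M; rewrite (eq_Lsum _ (shift k (x * u)%g F)) ?hLF // => v.
    by rewrite /shift mulgA.
  pose W x := \sum_g rho g * F (x * g)%g.
  (* [W] averages translates of [F] against [rho], so its L-sums tend to the averages of [LF], which
     are 0 by [LF0]. *)
  have hW u M : `|Lsum k (shift k u W) M| <= B / M.+1%:R.
    rewrite (Lsum_sum rho (fun g => shift k (u * g)%g F)); last first.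
      move=> v; apply: eq_bigr => g _; rewrite /shift -!mulgA; congr (_ * F (_ * _)%g).
      by rewrite mulC.
    have -> : \sum_g rho g * Lsum k (shift k (u * g)%g F) M =
        \sum_g rho g * (Lsum k (shift k (u * g)%g F) M - LF (u * g)%g).
      rewrite -[LHS]subr0 -[X in _ - X](LF0 u) -sumrB; apply: eq_bigr => g _.
      by rewrite mulrBr.
    apply: le_trans (ler_norm_sum _ _ _) _.
    rewrite -[X in _ <= X]mul1r -[X in _ <= X * _]rho1 mulr_suml; apply: ler_sum => g _.
    by rewrite normrM (ger0_norm (rho0 g)) ler_wpM2l.
  have RW : \sum_u W u * rho u = - W 1%g.
    by apply: (rhoE _ _ B) => N N0; rewrite mulNr opprK; apply: Psum_Lvanish_le.
  have WE x : W x = n * rho (x^-1 * c)%g - 1.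
    rewrite /W /F (eq_bigr (fun g => n * (rho g * ind (x^-1 * c)%g g) - rho g)); last first.
      move=> g _; rewrite /ind (can2_eq (mulKg x) (mulKVg x)); ring.
    by rewrite sumrB -mulr_sumr sum_ind rho1.
  move: RW; rewrite WE invg1 mul1g.
  rewrite (eq_bigr (fun g => n * (rho g * rho (g^-1 * c)%g) - rho g)); last first.
    by move=> g _; rewrite WE; ring.
  by rewrite sumrB -mulr_sumr rho1; lra.
have [chi [chi_pm chiM chi0 rhochi]] := density_character G rho a mulC rho0 rho1 rhoa rel.
have [LX hLX] := Lsum_limit k chi chi0; set B := 2 * l1norm k chi in hLX.
have shiftE u M : Lsum k (shift k u chi) M = chi u * Lsum k chi M.
  rewrite /Lsum mulr_sumr; apply: eq_bigr => m _; rewrite mulrA; congr (_ / _).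
  by rewrite /zext; case: insub => [v|]; [exact: chiM | rewrite mulr0].
have chi1 : chi 1%g = 1.
  by have := chiM 1%g 1%g; rewrite mulg1; case: (chi_pm 1%g) => ->; lra.
have h1 M : `|Lsum k chi M - LX 1%g| <= B / M.+1%:R.
  by have := hLX 1%g M; rewrite shiftE chi1 mul1r.
have h2 u M : `|Lsum k (shift k u chi) M - chi u * LX 1%g| <= B / M.+1%:R.
  rewrite shiftE -mulrBr normrM.
  by case: (chi_pm u) => ->; rewrite ?normrN normr1 mul1r.
(* The limit function of [chi] is [L(1, chi) * chi]. Its integral against [rho] is 0 by boundedness,
   and also [- L(1, chi)]. *)
have L0 : LX 1%g = 0.
  have : \sum_u (chi u * LX 1%g) * rho u = 0.
    apply: (rhoE _ _ (4 * l1norm k chi + 8 * B)) => N N0.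
    by rewrite mul0r subr0; apply: Psum_Llimit_le.
  rewrite (eq_bigr (fun u => LX 1%g * (rho u * chi u))); last by move=> u _; ring.
  by rewrite -mulr_sumr rhochi; lra.
apply: (real_character_Lsum_nonvanishing k chi chi_pm chiM chi0 B) => M.
by have := h1 M; rewrite L0 subr0.
Qed.

End PrimesInClasses.

(** Otherwise the class of [a] receives a contribution from [d = a] alone, and its [Psum] is bounded
    by [vonMangoldt a / a]. One positive term is enough to make the series for [c] positive. *)
Lemma prime_power_in_progression (a q : nat) : (0 < a)%N -> (a < q)%N ->
  coprime a q -> exists n, 0 < vonMangoldt (q * n.+1 + a).
Proof.
move=> a0 aq cop; case: q aq cop => [|[|k]] // aq cop; first by lia.
have ua : (inZp a : 'I_k.+2) \is a GRing.unit.
  by have := unitZpE a (isT : (1 < k.+2)%N); rewrite Zp_nat coprime_sym cop.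
pose u : {unit 'I_k.+2} := Sub (inZp a : 'I_k.+2) ua.
apply: Classical_Prop.NNPP => hno.
have L0 n : vonMangoldt (k.+2 * n.+1 + a) = 0.
  apply/eqP; rewrite eq_le vonMangoldt_ge0 andbT leNgt; apply/negP => h.
  by apply: hno; exists n.
have La0 : 0 <= vonMangoldt a / a%:R by rewrite divr_ge0 ?vonMangoldt_ge0 ?ler0n.
apply: (primes_in_class_unbounded k u (vonMangoldt a / a%:R)) => N.
apply: le_trans (_ : \sum_(1 <= d < N.+1 | d == a) vonMangoldt a / a%:R <= _); last first.
  by rewrite big_nat1_eq; case: ifP.
rewrite [X in _ <= X]big_mkcond; apply: ler_sum => d _.
case: eqP => [->|da].
  rewrite -[X in _ <= X]mulr1 ler_wpM2l //.
  by rewrite /zext; case: insub => [v|]; rewrite ?ler01 // /ind; case: eqP => *; rewrite ?ler01.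
rewrite /zext; case: zclassP => [v e|_]; last by rewrite mulr0.
rewrite /ind; case: eqP => [vu|_]; last by rewrite mulr0.
rewrite vu in e; have /= := congr1 val e; rewrite [(a %% _)%N]modn_small // => dm.
have := divn_eq d k.+2; rewrite dm mulnC; case: (d %/ k.+2)%N => [|j] E.
  by case: da; rewrite E muln0.
by rewrite E L0 !mul0r.
Qed.

(** * Sums over [x / n] *)

Lemma sum_indicator_le (X Y : nat) : (Y <= X)%N ->
  \sum_(1 <= n < X.+1) (n <= Y)%:R = Y%:R :> R.
Proof.
move=> YX; rewrite (big_cat_nat (n := Y.+1)) //= [X in _ + X]big_nat_cond.
rewrite [X in _ + X]big1 => [|n /andP[/andP[h _] _]]; last by rewrite leqNgt h.
rewrite addr0 (eq_big_nat _ _ (F2 := fun=> 1)) => [|n /andP[_ h]]; last by rewrite -ltnS h.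
by rewrite sumr_const_nat subn1.
Qed.

(** [n <= X %/ i] is equivalent to [i <= X %/ n], so the difference of indicators at [j] and [j.+1]
    singles out [j = X %/ n]. *)
Lemma sum_floor_div (h : nat -> R) (X : nat) :
  \sum_(1 <= n < X.+1) h (X %/ n)%N =
  \sum_(1 <= j < X.+1) h j * ((X %/ j)%:R - (X %/ j.+1)%:R).
Proof.
transitivity (\sum_(1 <= n < X.+1) \sum_(1 <= j < X.+1)
    h j * ((n <= X %/ j)%:R - (n <= X %/ j.+1)%:R)).
  apply: eq_big_nat => n /andP[n0 nX].
  have -> : h (X %/ n)%N = \sum_(1 <= j < X.+1 | j == (X %/ n)%N) h j.
    by rewrite big_nat1_eq ltnS leq_div divn_gt0 // -ltnS nX.
  rewrite big_mkcond; apply: eq_big_nat => j /andP[j0 jX].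
  have sw i : (0 < i)%N -> (n <= X %/ i)%N = (i <= X %/ n)%N.
    by move=> i0; rewrite !leq_divRL // mulnC.
  rewrite !sw // eqn_leq; case: leqP => h1; case: leqP => h2 /=;
    rewrite ?subrr ?subr0 ?mulr1 ?mulr0 //; lia.
rewrite exchange_big_nat /=; apply: eq_bigr => j _.
by rewrite -mulr_sumr sumrB !sum_indicator_le ?leq_div.
Qed.

Lemma exists_nat_sqrt (X : nat) : exists J, (J * J <= X < J.+1 * J.+1)%N.
Proof.
elim: X => [|X [J hJ]]; first by exists 0%N.
have [h|h] := ltnP X.+1 (J.+1 * J.+1); first by exists J; lia.
by exists J.+1; lia.
Qed.

Lemma telescope_inv (M N : nat) : (M <= N)%N ->
  \sum_(M.+1 <= j < N.+1) (j%:R * j.+1%:R)^-1 = M.+1%:R^-1 - N.+1%:R^-1 :> R.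
Proof.
move=> MN; rewrite -[RHS]opprB -(telescope_sumr (fun j => j%:R^-1)) // -sumrN.
apply: eq_big_nat => j /andP[j0 _]; rewrite opprB -[j.+1%:R]natr1.
have jp : 0 < j%:R :> R by rewrite ltr0n; lia.
by field; rewrite !gt_eqF //; lra.
Qed.

Lemma sum_floor_div_approx (h : nat -> R) (H : R) (X : nat) : (0 < X)%N ->
  (forall j, 0 <= h j) -> (forall j, (0 < j <= X)%N -> h j <= H) ->
  `|\sum_(1 <= n < X.+1) h (X %/ n)%N -
    X%:R * \sum_(1 <= j < X.+1) h j / (j%:R * j.+1%:R)| <= 3 * H * Num.sqrt X%:R.
Proof.
move=> X0 h0 hH; have H0 : 0 <= H := le_trans (h0 1%N) (hH 1%N ltac:(lia)).
have [J /andP[J1 J2]] := exists_nat_sqrt X.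
have JX : (J <= X)%N by nia.
have Xp : 0 < X%:R :> R by rewrite ltr0n.
have sX0 : 0 < Num.sqrt X%:R :> R by rewrite sqrtr_gt0.
have sX2 : Num.sqrt X%:R ^+ 2 = X%:R :> R by rewrite sqr_sqrtr ?ler0n.
have JsX : J%:R <= Num.sqrt X%:R :> R.
  rewrite -[J%:R]ger0_norm ?ler0n // -sqrtr_sqr ler_sqrt ?ler0n //.
  by rewrite expr2 -natrM ler_nat.
have sXJ : Num.sqrt X%:R <= J.+1%:R :> R.
  rewrite -[J.+1%:R]ger0_norm ?ler0n // -sqrtr_sqr ler_sqrt ?exprn_ge0 ?ler0n //.
  by rewrite expr2 -natrM ler_nat ltnW.
have XJ : X%:R / J.+1%:R <= Num.sqrt X%:R :> R.
  by rewrite ler_pdivrMr ?ltr0n // -{1}sX2 expr2 ler_wpM2l // ltW.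
pose D j : R := ((X %/ j)%:R - (X %/ j.+1)%:R) - X%:R / (j%:R * j.+1%:R).
rewrite sum_floor_div mulr_sumr -sumrB.
rewrite (eq_bigr (fun j => h j * D j)) => [|j _]; last by rewrite /D; ring.
rewrite (big_cat_nat (n := J.+1)) //=.
have fl j : (0 < j)%N ->
    ((X %/ j)%:R <= X%:R / j%:R :> R) && (X%:R / j%:R < (X %/ j)%:R + 1 :> R).
  move=> j0; rewrite ler_pdivlMr ?ltr0n // ltr_pdivrMr ?ltr0n //.
  by rewrite natr1 -!natrM ler_nat ltr_nat leq_trunc_div ltn_ceil.
have e j : (0 < j)%N -> X%:R / (j%:R * j.+1%:R) = X%:R / j%:R - X%:R / j.+1%:R :> R.
  move=> j0; have jp : 0 < j%:R :> R by rewrite ltr0n.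
  by rewrite -[j.+1%:R]natr1; field; rewrite !gt_eqF //; lra.
(* [D j] is a difference of two fractional parts, hence at most 1 in absolute value. *)
have b1 : `|\sum_(1 <= j < J.+1) h j * D j| <= H * J%:R.
  apply: le_trans (ler_norm_sum _ _ _) _.
  apply: le_trans (_ : \sum_(1 <= j < J.+1) H <= _); last first.
    by rewrite sumr_const_nat subn1 mulr_natr.
  rewrite big_nat_cond [X in _ <= X]big_nat_cond.
  apply: ler_sum => j /andP[/andP[j0 jJ] _].
  have hj : (0 < j <= X)%N by lia.
  rewrite normrM ger0_norm // -[X in _ <= X]mulr1 ler_pM ?hH //.
  have /andP[f1 f2] := fl j j0; have /andP[f3 f4] := fl j.+1 isT.
  rewrite /D (e j j0) ler_norml.
  move: (X%:R / j%:R) (X%:R / j.+1%:R) f1 f2 f3 f4 => u v f1 f2 f3 f4.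
  by apply/andP; split; lra.
(* Beyond [J] no cancellation is used: the two parts of [D j] telescope separately, each to at most
   [X / J.+1]. *)
have b2 : `|\sum_(J.+1 <= j < X.+1) h j * D j| <= H * (2 * (X%:R / J.+1%:R)).
  apply: le_trans (ler_norm_sum _ _ _) _.
  apply: le_trans (_ : \sum_(J.+1 <= j < X.+1)
     H * (- ((X %/ j.+1)%:R - (X %/ j)%:R) + X%:R * (j%:R * j.+1%:R)^-1) <= _).
    rewrite big_nat_cond [X in _ <= X]big_nat_cond.
    apply: ler_sum => j /andP[/andP[j0 jJ] _].
    have hj : (0 < j <= X)%N by lia.
    rewrite normrM ger0_norm // ler_pM ?hH //.
    rewrite /D; apply: le_trans (ler_normB _ _) _; apply: lerD.
      by rewrite opprB ger0_norm // subr_ge0 ler_nat leq_div2l //; lia.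
    by rewrite ger0_norm // divr_ge0 ?mulr_ge0 ?ler0n.
  rewrite -mulr_sumr ler_wpM2l // big_split /= sumrN telescope_sumr //.
  rewrite -mulr_sumr telescope_inv // (divn_small (ltnSn X)) sub0r opprK.
  have /andP[f1 _] := fl J.+1 isT.
  have f2 : 0 <= X%:R * X.+1%:R^-1 :> R by rewrite divr_ge0 ?ler0n.
  rewrite mulrBr; move: (X%:R / J.+1%:R) f1 (X%:R * X.+1%:R^-1) f2 => u f1 v f2.
  by lra.
apply: le_trans (ler_normD _ _) _; apply: le_trans (lerD b1 b2) _.
have c1 := ler_wpM2l H0 JsX; have c2 := ler_wpM2l H0 XJ.
by move: (X%:R / J.+1%:R) c2 => u c2; lra.
Qed.

Section SeriesWithRate.
Variables (h : nat -> R) (Q : R).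
Hypothesis h_ge0 : forall j, 0 <= h j.
Hypothesis h_le : forall j, (0 < j)%N -> h j <= Q * Num.sqrt j%:R.
Local Notation s N := (\sum_(1 <= j < N.+1) h j / (j%:R * j.+1%:R)).

(** Each term is at most [2 Q (1 / sqrt j - 1 / sqrt (j + 1))], which telescopes. *)
Lemma partial_sum_tail (M N : nat) : (M <= N)%N ->
  s M <= s N <= s M + 2 * Q / Num.sqrt M.+1%:R.
Proof.
move=> MN; have Q0 : 0 <= Q.
  by have := le_trans (h_ge0 1%N) (h_le 1%N isT); rewrite sqrtr1 mulr1.
rewrite (big_cat_nat (n := M.+1) (p := N.+1)) //= lerDl lerD2l.
apply/andP; split.
  by apply: sumr_ge0 => j _; rewrite divr_ge0 ?mulr_ge0 ?ler0n.
apply: le_trans (_ : \sum_(M.+1 <= j < N.+1)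
   - (2 * Q * ((Num.sqrt j.+1%:R)^-1 - (Num.sqrt j%:R)^-1)) <= _).
  rewrite big_nat_cond [X in _ <= X]big_nat_cond.
  apply: ler_sum => j /andP[/andP[jM _] _].
  have j0 : (0 < j)%N by lia.
  have [a0 b0 ab b2 a2] := sqrt_natS_bounds j.
  have a0' : 0 < Num.sqrt j%:R :> R by rewrite sqrtr_gt0 ltr0n.
  have jp : 0 < j%:R * j.+1%:R :> R by rewrite mulr_gt0 ?ltr0n.
  apply: le_trans (_ : Q * Num.sqrt j%:R / (j%:R * j.+1%:R) <= _).
    by rewrite ler_wpM2r ?h_le // invr_ge0 ltW.
  have -> : j.+1%:R = Num.sqrt j.+1%:R ^+ 2 :> R by rewrite sqr_sqrtr ?ler0n.
  rewrite -a2 sqrtr_sqr sqrtr_sqr (ger0_norm a0) (gtr0_norm b0).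
  move: a0' b0 ab b2; set a := Num.sqrt _; set b := Num.sqrt _ => a0' b0 ab b2.
  have -> : Q * a / (a ^+ 2 * b ^+ 2) = Q / (a * b ^+ 2).
    by field; rewrite !gt_eqF.
  have -> : - (2 * Q * (b^-1 - a^-1)) = Q * (2 * b * (b - a)) / (a * b ^+ 2).
    by field; rewrite !gt_eqF.
  have p0 : 0 <= (a * b ^+ 2)^-1 by rewrite invr_ge0 ltW // mulr_gt0 // exprn_gt0.
  rewrite ler_wpM2r //.
  (* With [a <= b], [2 b (b - a) >= (b + a) (b - a) = 1]. *)
  rewrite -{1}[Q]mulr1 ler_wpM2l //; nra.
rewrite sumrN -mulr_sumr telescope_sumr // -mulrN opprB ler_wpM2l ?mulr_ge0 //.
by rewrite gerBl invr_ge0 sqrtr_ge0.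
Qed.

Lemma series_with_rate : exists c : R,
  is_series (fun n => h n.+1 / (n.+1%:R * n.+2%:R)) c /\
  forall M, s M <= c <= s M + 2 * Q / Num.sqrt M.+1%:R.
Proof.
pose E (x : R) := exists M, x = s M.
have Q0 : 0 <= Q.
  by have := le_trans (h_ge0 1%N) (h_le 1%N isT); rewrite sqrtr1 mulr1.
have ub M N : s N <= s M + 2 * Q / Num.sqrt M.+1%:R.
  have [MN|NM] := leqP M N; first by case/andP: (partial_sum_tail M N MN).
  have /andP[h1 _] := partial_sum_tail N M (ltnW NM).
  by apply: le_trans h1 _; rewrite lerDl divr_ge0 ?mulr_ge0 ?sqrtr_ge0.
have [||c [hub hlub]] := completeness E.
- exists (s 0%N + 2 * Q / Num.sqrt 1%:R) => x [M ->]; exact/RleP/(ub 0%N).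
- by exists (s 0%N), 0%N.
have bd M : s M <= c <= s M + 2 * Q / Num.sqrt M.+1%:R.
  apply/andP; split; first by apply/RleP/hub; exists M.
  by apply/RleP/hlub => x [N ->]; exact/RleP/ub.
exists c; split=> //.
change (is_lim_seq (sum_n (fun n => h n.+1 / (n.+1%:R * n.+2%:R))) c).
apply: (is_lim_seq_ext (fun n => s n.+1)).
  by move=> n; rewrite sum_n_Reals sum_f_R0E big_add1.
apply/is_lim_seq_spec => e.
have e0 : 0 < pos e by apply/RltP; exact: cond_pos.
pose B := Num.bound ((2 * Q / (e : R)) ^+ 2).
exists B => n hn; apply/RltP; rewrite RabsE RminusE.
have /andP[h1 h2] := bd n.+1.
have sp : 0 < Num.sqrt n.+2%:R :> R by rewrite sqrtr_gt0 ltr0n.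
have h3 : 2 * Q / Num.sqrt n.+2%:R < pos e.
  rewrite ltr_pdivrMr // [X in _ < X]mulrC -ltr_pdivrMr //.
  have q0 : 0 <= 2 * Q / pos e by rewrite divr_ge0 ?mulr_ge0 // ltW.
  rewrite -[X in X < _](ger0_norm q0) -sqrtr_sqr ltr_sqrt ?ltr0n //.
  apply: lt_le_trans (archi_boundP (exprn_ge0 2 q0)) _.
  by rewrite ler_nat -/B; lia.
by rewrite ltr_norml; apply/andP; split; lra.
Qed.

End SeriesWithRate.

(** * Reduction from real to integer argument and the asymptotic formula *)

Lemma floor_natP (t : R) : 0 <= t ->
  (floor_nat t)%:R <= t < (floor_nat t).+1%:R.
Proof.
move=> t0; have [h1 h2] := base_Int_part t.
have z0 : Z.le 0 (Int_part t).
  have : Rlt (-1) (IZR (Int_part t)) by move/RleP: t0; rewrite -R0E => t0; Lra.lra.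
  by move/lt_IZR; Lia.lia.
have e : (floor_nat t)%:R = IZR (Int_part t).
  by rewrite -INRE INR_IZR_INZ /floor_nat Znat.Z2Nat.id.
rewrite -natr1 e; apply/andP; split; first exact/RleP.
by apply/RltP; rewrite -RplusE -R1E; Lra.lra.
Qed.

(** Multiples of [n] are integers, so they compare with [x] in the same way as with its integer
    part. *)
Lemma floor_nat_div (x : R) (n : nat) : 0 <= x -> (0 < n)%N ->
  floor_nat (x / n%:R)%R = (floor_nat x %/ n)%N.
Proof.
move=> x0 n0; have np : 0 < n%:R :> R by rewrite ltr0n.
have /andP[h1 h2] := floor_natP x x0.
have /andP[h3 h4] := floor_natP (x / n%:R)%R (divr_ge0 x0 (ltW np)).
move: h3 h4; rewrite ler_pdivlMr // ltr_pdivrMr // -!natrM => h3 h4.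
set X := floor_nat x in h1 h2 *; set m := floor_nat _ in h3 h4 *.
have a1 : (m * n < X.+1)%N by rewrite -(ltr_nat R); apply: le_lt_trans h3 h2.
have a2 : (X < m.+1 * n)%N by rewrite -(ltr_nat R); apply: le_lt_trans h1 h4.
apply/eqP; rewrite eqn_leq leq_divRL // -ltnS a1 /=.
by rewrite -ltnS ltn_divLR.
Qed.

Lemma sum_n_m_bigE (f : nat -> R) (N : nat) :
  sum_n_m f 1 N = \sum_(1 <= n < N.+1) f n.
Proof.
elim: N => [|N IH]; first by rewrite sum_n_m_zero ?big_geq //; Lia.lia.
rewrite sum_n_Sm; last exact/ssrnat.leP.
rewrite IH [RHS]big_nat_recr //=.
Qed.

Lemma S_sumE (a q : nat) (x : R) : 0 <= x ->
  S_sum a q x =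
  \sum_(1 <= n < (floor_nat x).+1) vonMangoldt (q * (floor_nat x %/ n) + a)%N.
Proof.
move=> x0; rewrite /S_sum sum_n_m_bigE; apply: eq_big_nat => n /andP[n0 _].
by rewrite RdivE INRE floor_nat_div.
Qed.

Lemma ln_le_sqrt (n : nat) : (0 < n)%N -> ln n%:R <= 2 * Num.sqrt n%:R.
Proof.
move=> n0; have s0 : 0 < Num.sqrt n%:R :> R by rewrite sqrtr_gt0 ltr0n.
have e : n%:R = Num.sqrt n%:R * Num.sqrt n%:R :> R by rewrite -expr2 sqr_sqrtr ?ler0n.
have -> : ln n%:R = ln (Num.sqrt n%:R) + ln (Num.sqrt n%:R).
  by rewrite {1}e; apply: ln_mult; apply/RltP.
have := ln_le_subr1 _ s0; lra.
Qed.

Lemma vonMangoldt_progression_le (a q j : nat) : (a < q)%N -> (0 < j)%N ->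
  vonMangoldt (q * j + a) <= ln (2 * q)%:R + ln j%:R.
Proof.
move=> aq j0; have q0 : (0 < 2 * q)%N by lia.
by apply: le_trans (vonMangoldt_le_ln _) _; rewrite -ln_natM // ler_ln_nat //; nia.
Qed.

Lemma sqrt_le_Rpower (x e : R) : 1 <= x -> Rle (/ 2) e -> Num.sqrt x <= Rpower x e.
Proof.
move=> x1 he; rewrite -RsqrtE -Rpower_sqrt; last by apply/RltP; rewrite R0E; lra.
by apply/RleP/Rle_Rpower => //; exact/RleP.
Qed.

(** The termwise bound by [c] reduces positivity of [c] to one positive term. The error has exponent
    [1 / 2], below the exponent required in the end. *)
Lemma S_sum_asymptotic (a q : nat) : (a < q)%N ->
  exists c : R,
    [/\ is_series (fun n => vonMangoldt (q * n.+1 + a) / (n.+1%:R * n.+2%:R)) c,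
        forall n, vonMangoldt (q * n.+1 + a) / (n.+1%:R * n.+2%:R) <= c &
        exists C : R, 0 <= C /\ forall x : R, 3 <= x ->
          `|S_sum a q x - c * x| <= C * (Num.sqrt x * ln x ^+ 2)].
Proof.
move=> aq; pose h j := vonMangoldt (q * j + a); pose l := ln (2 * q)%:R.
have l0 : 0 <= l by exact: ln_nat_ge0.
have h0 j : 0 <= h j by exact: vonMangoldt_ge0.
have hQ j : (0 < j)%N -> h j <= (l + 2) * Num.sqrt j%:R.
  move=> j0; apply: le_trans (vonMangoldt_progression_le a q j aq j0) _.
  have h1 := ln_le_sqrt j j0.
  have h2 : 1 <= Num.sqrt j%:R :> R by rewrite -[X in X <= _]sqrtr1 ler_sqrt ?ler0n // ler1n.
  rewrite -/l mulrDl; nra.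
have [c [hser hrate]] := series_with_rate h (l + 2) h0 hQ.
have c0 : 0 <= c by have /andP[+ _] := hrate 0%N; rewrite big_geq.
exists c; split=> //.
  move=> n; have /andP[+ _] := hrate n.+1; apply: le_trans; rewrite big_nat_recr //=.
  by rewrite lerDr sumr_ge0 // => j _; rewrite divr_ge0 ?mulr_ge0 ?ler0n.
(* In order: the error of [sum_floor_div_approx], the tail of the series beyond [X], and the
   replacement of [X] by [x]. *)
exists (3 * l + 3 + 2 * (l + 2) + c); split; first by lra.
move=> x x3; have x0 : 0 <= x by lra.
rewrite S_sumE //; set X := floor_nat x.
have /andP[Xx xX] := floor_natP x x0; rewrite -/X in Xx xX.
have X0 : (0 < X)%N.
  by rewrite lt0n; apply/negP => /eqP e; rewrite e in xX; lra.
(* Here [x >= 3 >= e] is used; it lets [ln x] absorb the constants and raises [ln x] to its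
   square. *)
have lnx1 : 1 <= ln x.
  have h3 : exp 1 <= 3 by apply/RleP; exact: exp_le_3.
  have := ln_ler _ _ (_ : 0 < exp 1) (le_trans h3 x3).
  by rewrite ln_exp; apply; apply/RltP/exp_pos.
have Xp : 0 < X%:R :> R by rewrite ltr0n.
have lnX : ln X%:R <= ln x by exact: ln_ler.
have sXx : Num.sqrt X%:R <= Num.sqrt x by rewrite ler_sqrt // ltW.
have sx1 : 1 <= Num.sqrt x by rewrite -[X in X <= _]sqrtr1 ler_sqrt //; lra.
have sX0 : 0 <= Num.sqrt X%:R :> R by exact: sqrtr_ge0.
have a1 := sum_floor_div_approx h (l + ln X%:R) X X0 h0.
have {}a1 : `|\sum_(1 <= n < X.+1) h (X %/ n)%N -
    X%:R * \sum_(1 <= j < X.+1) h j / (j%:R * j.+1%:R)| <= 3 * (l + ln x) * Num.sqrt x.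
  apply: le_trans (a1 _) _.
    move=> j /andP[j0 jX]; apply: le_trans (vonMangoldt_progression_le a q j aq j0) _.
    by rewrite lerD2l ler_ln_nat.
  apply: ler_pM => //; first by rewrite mulr_ge0 ?addr_ge0 ?ln_nat_ge0.
  by rewrite ler_pM2l ?ltr0n // lerD2l.
have /andP[r1 r2] := hrate X.
set s := \sum_(1 <= j < X.+1) h j / (j%:R * j.+1%:R) in a1 r1 r2.
have a2 : X%:R * (c - s) <= 2 * (l + 2) * Num.sqrt x.
  apply: le_trans (_ : X%:R * (2 * (l + 2) / Num.sqrt X%:R) <= _).
    rewrite ler_wpM2l ?ler0n //.
    rewrite lerBlDl; apply: le_trans r2 _; rewrite lerD2l ler_wpM2l //.
      by rewrite mulr_ge0 ?addr_ge0.
    exact: inv_sqrt_antitone.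
  have -> : X%:R * (2 * (l + 2) / Num.sqrt X%:R) = 2 * (l + 2) * Num.sqrt X%:R.
    rewrite -{1}[X%:R](sqr_sqrtr (ltW Xp)); field.
    by rewrite gt_eqF // sqrtr_gt0.
  by rewrite ler_wpM2l // mulr_ge0 // addr_ge0.
have a2' : 0 <= X%:R * (c - s) by rewrite mulr_ge0 ?ler0n // subr_ge0.
have a3 : 0 <= c * (x - X%:R) <= c.
  by rewrite mulr_ge0 ?subr_ge0 //= ler_piMr //; move: xX; rewrite -natr1; lra.
apply: le_trans (_ : (3 * l + 3 + 2 * (l + 2) + c) * (Num.sqrt x * ln x) <= _); last first.
  rewrite ler_wpM2l //; first by lra.
  by rewrite ler_wpM2l ?sqrtr_ge0 // expr2 ler_peMr //; lra.
have sl : Num.sqrt x <= Num.sqrt x * ln x by rewrite ler_peMr // sqrtr_ge0.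
have sl1 : 1 <= Num.sqrt x * ln x by lra.
apply: le_trans (_ : 3 * (l + ln x) * Num.sqrt x + 2 * (l + 2) * Num.sqrt x + c <= _).
  case/andP: a3 => a3 a4; rewrite -/(h _).
  move: a1; rewrite !ler_norml => /andP[b1 b2]; apply/andP; split; lra.
have k1 := ler_wpM2l l0 sl; have k2 := ler_wpM2l c0 sl1.
nra.
Qed.

Open Scope R_scope.

Theorem theorem1p2 (a q : nat) (eps : R) :
  (0 < a)%nat -> (a < q)%nat -> gcdn a q = 1%nat -> 0 < eps ->
  exists c : R,
    is_series (fun n : nat =>
      vonMangoldt (q * n.+1 + a)%N / (INR n.+1 * INR n.+2)) c /\
    0 < c /\
    exists C X0 : R, forall x : R, X0 <= x ->
      Rabs (S_sum a q x - c * x) <= C * (Rpower x ((2 + eps) / 3) * (ln x) ^ 2).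
Proof.
move=> a0 aq /eqP cop eps0.
have [c [hser hterm [C [C0 hC]]]] := S_sum_asymptotic a q aq.
exists c; split; last split.
- by apply: is_series_ext hser => n; rewrite !INRE.
- have [n hn] := prime_power_in_progression a q a0 aq cop.
  apply/RltP; apply: lt_le_trans (hterm n).
  by rewrite divr_gt0 // mulr_gt0 // ltr0n.
exists C, (3%:R)%R => x /RleP x3.
have x1 : Order.le (1%:R)%R x by apply: le_trans x3; rewrite ler_nat.
rewrite RmultE RabsE RminusE !RmultE RpowE; apply/RleP.
apply: le_trans (hC x x3) _; rewrite ler_wpM2l // ler_wpM2r ?exprn_even_ge0 //.
(* [(2 + eps) / 3] exceeds [1 / 2], so the square root bound implies the stated one. *)
by apply: sqrt_le_Rpower => //; Lra.lra.
Qed.
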